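(* If $\Gamma$ is an ellipse which is not a circle, then the matching problem for $\Gamma$ has only the trivial solution (every solution $(f,g)$ consists of constants).
   Context: For a Jordan curve $\Gamma$ with interior domain $\Omega$ and exterior domain $\Omega':=\widehat{\mathbb C}\setminus\overline\Omega$, a solution of the matching problem is a pair $(f,g)$ with: $f$ holomorphic in $\Omega$ and continuous on $\overline\Omega$; $g$ holomorphic in $\Omega'$, continuous on $\overline{\Omega'}$, with $g(\infty)=0$; and $f(\zeta)=\overline{g(\zeta)}$ for all $\zeta\in\Gamma$. It is non-trivial if $f,g$ are non-constant. *)

(* Defs.v *)
From Stdlib Require Import Reals.
From Coquelicot Require Import Coquelicot.
Open Scope R_scope.

Definition C_differentiable (f : C -> C) (z : C) : Prop :=
  ex_derive (K := C_AbsRing) (V := C_NormedModule) f z.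

Definition holomorphic_on (U : C -> Prop) (f : C -> C) : Prop :=
  forall z, U z -> C_differentiable f z.

Definition continuous_on (S : C -> Prop) (f : C -> C) : Prop :=
  forall z, S z -> filterlim f (within S (locally z)) (locally (f z)).

(* The ellipse with center c, semi-axes a, b > 0, rotated by angle th:
   Gamma = { c + e^{i th} (a cos t + i b sin t) }.  ell_q c a b th z < 1, = 1, > 1
   characterize the interior, the curve, and the (finite part of the) exterior. *)
Definition ell_q (c : C) (a b th : R) (z : C) : R :=
  let w := Cmult (Cminus z c) (cos th, - sin th) in
  (Re w / a) ^ 2 + (Im w / b) ^ 2.

Definition ellipse (c : C) (a b th : R) : C -> Prop := fun z => ell_q c a b th z = 1.
Definition ell_interior (c : C) (a b th : R) : C -> Prop := fun z => ell_q c a b th z < 1.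
Definition ell_interior_closure (c : C) (a b th : R) : C -> Prop := fun z => ell_q c a b th z <= 1.
(* finite points of the exterior domain Omega' (Omega' also contains infinity) *)
Definition ell_exterior (c : C) (a b th : R) : C -> Prop := fun z => 1 < ell_q c a b th z.
Definition ell_exterior_closure (c : C) (a b th : R) : C -> Prop := fun z => 1 <= ell_q c a b th z.

(* g read in the chart w = 1/z at infinity, with the value g(infinity) := 0 *)
Definition chart_at_infty (g : C -> C) : C -> C :=
  fun w => if Req_EM_T (Cmod w) 0 then RtoC 0 else g (Cinv w).

Definition matching_solution (c : C) (a b th : R) (f g : C -> C) : Prop :=
  holomorphic_on (ell_interior c a b th) f /\
  continuous_on (ell_interior_closure c a b th) f /\
  holomorphic_on (ell_exterior c a b th) g /\
  (* g holomorphic at infinity with g(infinity) = 0 *)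
  C_differentiable (chart_at_infty g) (RtoC 0) /\
  continuous_on (ell_exterior_closure c a b th) g /\
  (forall z, ellipse c a b th z -> f z = Cconj (g z)).

(* Main.v *)
Require Import Defs.
From Stdlib Require Import Reals.
From Coquelicot Require Import Coquelicot.
From Stdlib Require Import ZArith Lra Lia ClassicalEpsilon.
Open Scope R_scope.

(** In elliptic coordinates [z = c + e^(i th) k cosh (x + i y)] the ellipse is the line [x = x0],
    its interior is covered by [|x| < x0] and its exterior by [x > x0].  The pulled back functions
    [F] and [G] are [2 pi i]-periodic, so by Goursat's theorem on rectangles the quantities
    [e^(- n x) * int F (x + i y) e^(- i n y) dy] do not depend on [x], and likewise for [G].
    Letting [x] tend to infinity kills those of [G] with [n >= 0], hence, by [F = conj G] on the
    curve, those of [F] with [n <= 0].  Since [z] is even in [x + i y], so is [F]; comparing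
    [x = x0] with [x = - x0] relates the indices [n] and [- n] and kills the remaining ones.
    A continuous function all of whose Fourier coefficients vanish is zero. *)

(** The circle shows the obstacle: on the unit circle [f z = z ^ n] and [g z = 1 / z ^ n] match for
    every n >= 1, since nothing there ties the positive frequencies of f to the negative ones. For
    an ellipse with focal distance k > 0, the line x = 0 folds onto the segment between the foci, so
    F lives on the symmetric strip |x| <= x0 and is even. With M n the moment of F at x0, invariance
    between - x0 and x0 reads e^(n x0) M (- n) = e^(- n x0) M n, so M (- n) = 0 forces M n = 0.
    Frequency 0 dies because g vanishes at infinity, which is why both constants turn out to be 0.

    Holomorphic means differentiable at each point, with no continuity of the derivative at hand;
    hence Goursat's bisection instead of Green's formula. On the curve itself only continuity is
    known, so the lines x = x0 and x = - x0 are reached as limits of inner lines. Invariance also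
    carries the vanishing moments from x0 to every other x, which gives f = 0 and g = 0 on the whole
    closed domains without the identity theorem or the maximum principle. *)

(** * Goursat's theorem for closed forms on rectangles *)

(* [P dx + Q dy] is differentiable at [(x0, y0)] with the symmetric Jacobian
   [al be; be ga], i.e. closed there. *)
Definition closed_at (P Q : R -> R -> R) (x0 y0 : R) : Prop :=
  exists al be ga : R, forall eps, 0 < eps -> exists d, 0 < d /\
    forall x y, Rabs (x - x0) < d -> Rabs (y - y0) < d ->
      Rabs (P x y - P x0 y0 - al * (x - x0) - be * (y - y0))
        <= eps * (Rabs (x - x0) + Rabs (y - y0)) /\
      Rabs (Q x y - Q x0 y0 - be * (x - x0) - ga * (y - y0))
        <= eps * (Rabs (x - x0) + Rabs (y - y0)).

(** The counterclockwise boundary integral of [P dx + Q dy], with opposite sides paired so that they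
    can be estimated together. *)
Definition circulation (P Q : R -> R -> R) (x1 x2 y1 y2 : R) : R :=
  RInt (fun s => P s y1) x1 x2 - RInt (fun s => P s y2) x1 x2 +
  (RInt (fun t => Q x2 t) y1 y2 - RInt (fun t => Q x1 t) y1 y2).

Lemma continuous_slice1 (P : R -> R -> R) (y : R) :
  (forall x y, continuity_2d_pt P x y) ->
  forall x, continuous (fun s => P s y) x.
Proof.
  intros HP x. apply continuity_pt_filterlim.
  intros eps Heps.
  destruct (HP x y (mkposreal eps Heps)) as [d Hd].
  exists d; split; [apply cond_pos |].
  intros s [_ Hs]. apply Hd; [exact Hs |].
  rewrite Rminus_eq_0, Rabs_R0; apply cond_pos.
Qed.

Lemma continuous_slice2 (P : R -> R -> R) (x : R) :
  (forall x y, continuity_2d_pt P x y) ->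
  forall y, continuous (fun t => P x t) y.
Proof.
  intros HP y. apply continuity_pt_filterlim.
  intros eps Heps.
  destruct (HP x y (mkposreal eps Heps)) as [d Hd].
  exists d; split; [apply cond_pos |].
  intros s [_ Hs]. apply Hd; [| exact Hs].
  rewrite Rminus_eq_0, Rabs_R0; apply cond_pos.
Qed.

Lemma ex_RInt_continuous_everywhere (h : R -> R) (a b : R) :
  (forall t, continuous h t) -> ex_RInt h a b.
Proof. intros H. apply (ex_RInt_continuous (V := R_CompleteNormedModule)); auto. Qed.

Lemma RInt_Chasles_continuous (h : R -> R) (a b c : R) :
  (forall t, continuous h t) -> RInt h a c = RInt h a b + RInt h b c.
Proof.
  intros H. symmetry. apply (RInt_Chasles (V := R_CompleteNormedModule));
    apply ex_RInt_continuous_everywhere, H.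
Qed.

(** Each inner edge is run through twice, in opposite directions, and cancels. *)
Lemma circulation_bisect (P Q : R -> R -> R) (x1 xm x2 y1 ym y2 : R) :
  (forall x y, continuity_2d_pt P x y) -> (forall x y, continuity_2d_pt Q x y) ->
  circulation P Q x1 x2 y1 y2 =
  circulation P Q x1 xm y1 ym + circulation P Q xm x2 y1 ym +
  (circulation P Q x1 xm ym y2 + circulation P Q xm x2 ym y2).
Proof.
  intros HP HQ. unfold circulation.
  assert (EP : forall y, RInt (fun s => P s y) x1 x2 =
    RInt (fun s => P s y) x1 xm + RInt (fun s => P s y) xm x2).
  { intros y. apply RInt_Chasles_continuous, continuous_slice1; assumption. }
  assert (EQ : forall x, RInt (fun t => Q x t) y1 y2 =
    RInt (fun t => Q x t) y1 ym + RInt (fun t => Q x t) ym y2).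
  { intros x. apply RInt_Chasles_continuous, continuous_slice2; assumption. }
  rewrite !EP, !EQ. ring.
Qed.

(** Serves to compare two opposite sides of a rectangle: for a nearly linear form the integrands
    differ by almost a constant [c]. *)
Lemma RInt_diff_const_le (h1 h2 : R -> R) (a b c M : R) :
  a <= b -> (forall t, continuous h1 t) -> (forall t, continuous h2 t) ->
  (forall t, a <= t <= b -> Rabs (h1 t - h2 t - c) <= M) ->
  Rabs (RInt h1 a b - RInt h2 a b - (b - a) * c) <= (b - a) * M.
Proof.
  intros Hab H1 H2 HM.
  assert (E1 := ex_RInt_continuous_everywhere h1 a b H1).
  assert (E2 := ex_RInt_continuous_everywhere h2 a b H2).
  assert (E3 : ex_RInt (fun t => minus (h1 t) (h2 t)) a b)
    by (apply (ex_RInt_minus (V := R_NormedModule)); assumption).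
  assert (E4 : ex_RInt (fun _ : R => c) a b) by apply (ex_RInt_const (V := R_NormedModule)).
  replace (RInt h1 a b - RInt h2 a b - (b - a) * c)
    with (RInt (fun t => h1 t - h2 t - c) a b).
  - apply abs_RInt_le_const; auto.
    apply (ex_RInt_minus (V := R_NormedModule)); assumption.
  - transitivity (minus (RInt (fun t => minus (h1 t) (h2 t)) a b) (RInt (fun _ => c) a b)).
    + apply (RInt_minus (V := R_CompleteNormedModule)); assumption.
    + rewrite (RInt_minus (V := R_CompleteNormedModule)) by assumption.
      rewrite RInt_const. reflexivity.
Qed.

(** The affine part of a closed form has circulation [be * l * h - be * l * h = 0], by symmetry of
    the Jacobian. The remainder is at most [eps * (l + h)] for each pair of opposite sides,
    integrated over lengths l and h. *)
Lemma circulation_small (P Q : R -> R -> R) (x0 y0 : R) :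
  (forall x y, continuity_2d_pt P x y) -> (forall x y, continuity_2d_pt Q x y) ->
  closed_at P Q x0 y0 ->
  forall eps, 0 < eps -> exists d, 0 < d /\
    forall x1 x2 y1 y2, x1 <= x0 <= x2 -> y1 <= y0 <= y2 -> x2 - x1 < d -> y2 - y1 < d ->
      Rabs (circulation P Q x1 x2 y1 y2) <= eps * (x2 - x1 + (y2 - y1)) ^ 2.
Proof.
  intros HP HQ (al & be & ga & H) eps Heps.
  destruct (H (eps / 2)) as (d & Hd & Hde); [lra |].
  exists d; split; [exact Hd |].
  intros x1 x2 y1 y2 Hx Hy Hl Hh.
  set (l := x2 - x1) in *; set (h := y2 - y1) in *.
  assert (Hl0 : 0 <= l) by (unfold l; lra). assert (Hh0 : 0 <= h) by (unfold h; lra).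
  assert (A : forall x y, x1 <= x <= x2 -> y1 <= y <= y2 ->
    Rabs (P x y - P x0 y0 - al * (x - x0) - be * (y - y0)) <= eps / 2 * (l + h) /\
    Rabs (Q x y - Q x0 y0 - be * (x - x0) - ga * (y - y0)) <= eps / 2 * (l + h)).
  { intros x y Ix Iy.
    assert (Rabs (x - x0) <= l) by (apply Rabs_le; unfold l; lra).
    assert (Rabs (y - y0) <= h) by (apply Rabs_le; unfold h; lra).
    destruct (Hde x y) as [U V]; [lra | lra |].
    assert (eps / 2 * (Rabs (x - x0) + Rabs (y - y0)) <= eps / 2 * (l + h))
      by (apply Rmult_le_compat_l; lra).
    lra. }
  assert (B1 : Rabs (RInt (fun s => P s y1) x1 x2 - RInt (fun s => P s y2) x1 x2
                      - (x2 - x1) * (be * (y1 - y2))) <= (x2 - x1) * (eps * (l + h))).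
  { apply RInt_diff_const_le; [lra | apply continuous_slice1; auto ..|].
    intros s Hs.
    destruct (A s y1 Hs) as [U _]; [lra |]. destruct (A s y2 Hs) as [V _]; [lra |].
    apply Rabs_le_between in U; apply Rabs_le_between in V; apply Rabs_le_between. lra. }
  assert (B2 : Rabs (RInt (fun t => Q x2 t) y1 y2 - RInt (fun t => Q x1 t) y1 y2
                      - (y2 - y1) * (be * (x2 - x1))) <= (y2 - y1) * (eps * (l + h))).
  { apply RInt_diff_const_le; [lra | apply continuous_slice2; auto ..|].
    intros s Hs.
    destruct (A x2 s) as [_ U]; [lra | lra |]. destruct (A x1 s) as [_ V]; [lra | lra |].
    apply Rabs_le_between in U; apply Rabs_le_between in V; apply Rabs_le_between. lra. }
  unfold circulation.
  fold l in B1, B2; fold h in B1, B2.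
  apply Rabs_le_between in B1; apply Rabs_le_between in B2; apply Rabs_le_between.
  replace (y1 - y2) with (- h) in B1 by (unfold h; ring).
  nra.
Qed.

Lemma abs_sum4_ge (A a b c d : R) :
  A <= Rabs (a + b + (c + d)) ->
  A / 4 <= Rabs a \/ A / 4 <= Rabs b \/ A / 4 <= Rabs c \/ A / 4 <= Rabs d.
Proof.
  intros H.
  destruct (Rle_dec (A / 4) (Rabs a)); auto. destruct (Rle_dec (A / 4) (Rabs b)); auto.
  destruct (Rle_dec (A / 4) (Rabs c)); auto. destruct (Rle_dec (A / 4) (Rabs d)); auto.
  assert (T1 := Rabs_triang (a + b) (c + d)).
  assert (T2 := Rabs_triang a b). assert (T3 := Rabs_triang c d). lra.
Qed.

(** At stage n the side is [l / 2 ^ n]; the lower corner of the chosen half is the old corner or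
    lies half a side further. *)
Definition dyadic_step (l : R) (n : nat) (x x' : R) : Prop :=
  x' = x \/ x' = x + l / 2 ^ S n.

(** Nested intervals: X is the limit of the nondecreasing, bounded sequence of left endpoints. *)
Lemma dyadic_chain_limit (x : nat -> R) (l : R) :
  0 <= l -> (forall n, dyadic_step l n (x n) (x (S n))) ->
  exists X, forall n, x n <= X <= x n + l / 2 ^ n.
Proof.
  intros Hl Hs.
  assert (Hp : forall n, 0 <= l / 2 ^ n).
  { intros n. apply Rdiv_le_0_compat; [exact Hl | apply pow_lt; lra]. }
  assert (Hh : forall n, l / 2 ^ n = 2 * (l / 2 ^ S n)).
  { intros n. simpl. field. apply pow_nonzero; lra. }
  (* The interval of stage n + k lies inside that of stage n. *)
  assert (I : forall n k, x n <= x (n + k)%nat /\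
    x (n + k)%nat + l / 2 ^ (n + k) <= x n + l / 2 ^ n).
  { intros n k. induction k as [| k IH].
    - rewrite Nat.add_0_r. lra.
    - rewrite Nat.add_succ_r.
      assert (H1 := Hh (n + k)%nat). assert (H2 := Hp (S (n + k))).
      destruct (Hs (n + k)%nat) as [E | E]; rewrite E; lra. }
  destruct (growing_cv x) as [X HX].
  - intros n. destruct (I n 1%nat) as [H _]. rewrite Nat.add_1_r in H. exact H.
  - exists (x 0%nat + l / 2 ^ 0). intros r [n ->].
    destruct (I 0%nat n) as [_ H]. simpl Nat.add in H. specialize (Hp n). lra.
  - assert (LX : is_lim_seq x X) by (apply is_lim_seq_Reals; exact HX).
    exists X. intros n. split.
    + apply (is_lim_seq_le_loc (fun _ => x n) x (x n) X).
      * exists n. intros m Hm. replace m with (n + (m - n))%nat by lia. apply I.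
      * apply is_lim_seq_const.
      * exact LX.
    + apply (is_lim_seq_le_loc x (fun _ => x n + l / 2 ^ n) X (x n + l / 2 ^ n)).
      * exists n. intros m Hm. replace m with (n + (m - n))%nat by lia.
        destruct (I n (m - n)%nat) as [_ H]. specialize (Hp (n + (m - n))%nat). lra.
      * exact LX.
      * apply is_lim_seq_const.
Qed.

(** Dependent choice. The successor is given by an existential in [Prop], so indefinite description
    turns it into a function on pairs bundled with a proof of the invariant [G], which is then
    iterated. *)
Lemma dyadic_chain_exists (G : nat -> R -> R -> Prop) (l h x0 y0 : R) :
  G 0%nat x0 y0 ->
  (forall n x y, G n x y ->
     exists x' y', dyadic_step l n x x' /\ dyadic_step h n y y' /\ G (S n) x' y') ->
  exists x y : nat -> R,
    x 0%nat = x0 /\ y 0%nat = y0 /\ forall n, G n (x n) (y n) /\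
      dyadic_step l n (x n) (x (S n)) /\ dyadic_step h n (y n) (y (S n)).
Proof.
  intros G0 Hstep.
  assert (next : forall n (p : {p : R * R | G n (fst p) (snd p)}),
    {q : {q : R * R | G (S n) (fst q) (snd q)} |
      dyadic_step l n (fst (proj1_sig p)) (fst (proj1_sig q)) /\
      dyadic_step h n (snd (proj1_sig p)) (snd (proj1_sig q))}).
  { intros n [[x y] Hp]. apply constructive_indefinite_description.
    destruct (Hstep n x y Hp) as (x' & y' & Hx & Hy & HG).
    exists (exist _ (x', y') HG). simpl. auto. }
  set (s := fix s (n : nat) : {p : R * R | G n (fst p) (snd p)} :=
    match n with
    | O => exist (fun p => G 0%nat (fst p) (snd p)) (x0, y0) G0
    | S m => proj1_sig (next m (s m))
    end).
  exists (fun n => fst (proj1_sig (s n))), (fun n => snd (proj1_sig (s n))).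
  split; [reflexivity | split; [reflexivity |]].
  intros n. split.
  - exact (proj2_sig (s n)).
  - exact (proj2_sig (next n (s n))).
Qed.

(** Some quarter keeps at least a fourth of the absolute circulation, so stage n retains
    [K / 4 ^ n]. Closedness at the common point of the nested rectangles bounds it by an arbitrarily
    small multiple of the squared side sum, which also shrinks like [1 / 4 ^ n]. *)
Lemma goursat_rectangle (P Q : R -> R -> R) (x1 x2 y1 y2 : R) :
  x1 <= x2 -> y1 <= y2 ->
  (forall x y, continuity_2d_pt P x y) -> (forall x y, continuity_2d_pt Q x y) ->
  (forall x y, x1 <= x <= x2 -> y1 <= y <= y2 -> closed_at P Q x y) ->
  circulation P Q x1 x2 y1 y2 = 0.
Proof.
  intros Hx Hy HP HQ HC.
  destruct (Req_dec (circulation P Q x1 x2 y1 y2) 0) as [E | E]; [exact E | exfalso].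
  set (K := Rabs (circulation P Q x1 x2 y1 y2)).
  assert (HK : 0 < K) by (apply Rabs_pos_lt; exact E).
  set (l := x2 - x1). set (h := y2 - y1).
  assert (Hl : 0 <= l) by (unfold l; lra). assert (Hh : 0 <= h) by (unfold h; lra).
  assert (Half : forall r n, r / 2 ^ S n + r / 2 ^ S n = r / 2 ^ n).
  { intros r n. simpl. field. apply pow_nonzero; lra. }
  destruct (dyadic_chain_exists
    (fun n x y => K / 4 ^ n <=
       Rabs (circulation P Q x (x + l / 2 ^ n) y (y + h / 2 ^ n))) l h x1 y1)
    as (x & y & Ex & Ey & Hxy).
  { simpl. replace (x1 + l / 1) with x2 by (unfold l; field).
    replace (y1 + h / 1) with y2 by (unfold h; field). unfold K; lra. }
  { intros n x y HG.
    rewrite (circulation_bisect P Q x (x + l / 2 ^ S n) _ y (y + h / 2 ^ S n)) in HG by auto.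
    replace (K / 4 ^ S n) with (K / 4 ^ n / 4) by (simpl; field; apply pow_nonzero; lra).
    replace (x + l / 2 ^ n) with (x + l / 2 ^ S n + l / 2 ^ S n) in HG
      by (rewrite <- (Half l n); ring).
    replace (y + h / 2 ^ n) with (y + h / 2 ^ S n + h / 2 ^ S n) in HG
      by (rewrite <- (Half h n); ring).
    destruct (abs_sum4_ge _ _ _ _ _ HG) as [A | [A | [A | A]]].
    - exists x, y. repeat split; [left | left |]; auto.
    - exists (x + l / 2 ^ S n), y. repeat split; [right | left |]; auto.
    - exists x, (y + h / 2 ^ S n). repeat split; [left | right |]; auto.
    - exists (x + l / 2 ^ S n), (y + h / 2 ^ S n). repeat split; [right | right |]; auto. }
  destruct (dyadic_chain_limit x l Hl) as [X HX]; [intros n; apply Hxy |].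
  destruct (dyadic_chain_limit y h Hh) as [Y HY]; [intros n; apply Hxy |].
  assert (IX := HX 0%nat). assert (IY := HY 0%nat).
  rewrite Ex in IX; rewrite Ey in IY. simpl in IX, IY.
  assert (CXY : closed_at P Q X Y).
  { apply HC; [unfold l in IX | unfold h in IY]; lra. }
  (* Chosen so that [K = 2 * e * ((l + h) ^ 2 + 1)], which contradicts the bound
     [K <= e * (l + h) ^ 2] reached below; the added 1 keeps the denominator positive when
     [l + h = 0]. *)
  set (e := K / (2 * ((l + h) ^ 2 + 1))).
  assert (Hs : 0 <= (l + h) ^ 2) by apply pow2_ge_0.
  assert (He : 0 < e) by (apply Rdiv_lt_0_compat; lra).
  destruct (circulation_small P Q X Y HP HQ CXY e He) as (d & Hd & Hsmall).
  assert (Hn : exists n, (l + h) / 2 ^ n < d).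
  { destruct (pow_lt_1_zero (/ 2)) with (y := d / (l + h + 1)) as [n Hn].
    - rewrite Rabs_pos_eq; lra.
    - apply Rdiv_lt_0_compat; lra.
    - exists n. specialize (Hn n (le_n n)).
      rewrite Rabs_pos_eq in Hn by (apply pow_le; lra).
      rewrite pow_inv in Hn. apply Rlt_div_r in Hn; [| lra].
      assert (0 < / 2 ^ n) by (apply Rinv_0_lt_compat, pow_lt; lra).
      unfold Rdiv. lra. }
  destruct Hn as [n Hn].
  assert (P2 : 0 < 2 ^ n) by (apply pow_lt; lra).
  assert (Ln : 0 <= l / 2 ^ n) by (apply Rdiv_le_0_compat; lra).
  assert (Hhn : 0 <= h / 2 ^ n) by (apply Rdiv_le_0_compat; lra).
  assert (Sn : (l + h) / 2 ^ n = l / 2 ^ n + h / 2 ^ n) by (field; lra).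
  destruct (Hxy n) as [HG _].
  specialize (Hsmall (x n) (x n + l / 2 ^ n) (y n) (y n + h / 2 ^ n) (HX n) (HY n)).
  assert (B := Rle_trans _ _ _ HG (Hsmall ltac:(lra) ltac:(lra))).
  replace (x n + l / 2 ^ n - x n + (y n + h / 2 ^ n - y n)) with ((l + h) / 2 ^ n) in B
    by (rewrite Sn; ring).
  replace (4 ^ n) with (2 ^ n * 2 ^ n) in B by (rewrite <- Rpow_mult_distr; f_equal; ring).
  assert (B' : K <= e * (l + h) ^ 2).
  { apply (Rmult_le_compat_r (2 ^ n * 2 ^ n)) in B; [| nra].
    replace (K / (2 ^ n * 2 ^ n) * (2 ^ n * 2 ^ n)) with K in B by (field; lra).
    replace (e * ((l + h) / 2 ^ n) ^ 2 * (2 ^ n * 2 ^ n)) with (e * (l + h) ^ 2) in B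
      by (field; lra).
    exact B. }
  assert (Ke : K = 2 * e * ((l + h) ^ 2 + 1)) by (unfold e; field; lra).
  nra.
Qed.

(** * Periodic holomorphic functions on a strip *)

(** Uniform continuity along the compact segment; it carries the invariance of vertical integrals to
    the edges of the strip. *)
Lemma continuous_RInt_slice (Q : R -> R -> R) (a b x0 : R) :
  a <= b -> (forall x y, continuity_2d_pt Q x y) ->
  forall eps, 0 < eps -> exists d, 0 < d /\ forall x, Rabs (x - x0) < d ->
    Rabs (RInt (fun t => Q x t) a b - RInt (fun t => Q x0 t) a b) <= (b - a) * eps.
Proof.
  intros Hab HQ eps Heps.
  destruct (uniform_continuity_2d_1d' Q a b x0 (fun t _ => HQ x0 t) (mkposreal eps Heps))
    as [d Hd].
  exists d; split; [apply cond_pos |]. intros x Hx.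
  assert (D := cond_pos d). apply Rabs_lt_between in Hx.
  replace (RInt (fun t => Q x t) a b - RInt (fun t => Q x0 t) a b)
    with (RInt (fun t => Q x t) a b - RInt (fun t => Q x0 t) a b - (b - a) * 0) by ring.
  apply RInt_diff_const_le; [exact Hab | apply continuous_slice2; auto ..|].
  intros t Ht. rewrite Rminus_0_r. apply Rlt_le, Hd; try lra.
  rewrite Rminus_eq_0, Rabs_R0. exact D.
Qed.

(** The horizontal sides cancel by [P x a = P x b], so Goursat equates the vertical integrals.
    Closedness holds only in the open strip: Goursat is applied strictly inside, and each edge is
    then compared with the middle line by continuity. *)
Lemma closed_form_strip (P Q : R -> R -> R) (al be a b : R) :
  al < be -> a <= b ->
  (forall x y, continuity_2d_pt P x y) -> (forall x y, continuity_2d_pt Q x y) ->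
  (forall x, P x a = P x b) ->
  (forall x y, al < x < be -> closed_at P Q x y) ->
  RInt (fun t => Q al t) a b = RInt (fun t => Q be t) a b.
Proof.
  intros Hs Hab HP HQ Hper HC.
  set (I := fun x => RInt (fun t => Q x t) a b).
  assert (Hin : forall x1 x2, al < x1 -> x1 <= x2 -> x2 < be -> I x1 = I x2).
  { intros x1 x2 H1 H12 H2.
    assert (G := goursat_rectangle P Q x1 x2 a b H12 Hab HP HQ).
    unfold circulation in G.
    rewrite (RInt_ext (fun s => P s b) (fun s => P s a)) in G by (intros; auto).
    unfold I. enough (RInt (fun t => Q x2 t) a b - RInt (fun t => Q x1 t) a b = 0) by lra.
    rewrite <- G; [ring |]. intros; apply HC; lra. }
  set (m := (al + be) / 2).
  assert (E : forall e, (e = al \/ e = be) -> I e = I m).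
  { intros e He. apply Req_lt_aux. intros [eps Heps]. simpl.
    (* The added 1 covers the case [a = b]. *)
    assert (Hba : 0 < b - a + 1) by lra.
    destruct (continuous_RInt_slice Q a b e Hab HQ (eps / (b - a + 1))) as (d & Hd & Hc);
      [apply Rdiv_lt_0_compat; lra |].
    set (r := Rmin (d / 2) ((be - al) / 4)).
    assert (Hr : 0 < r) by (apply Rmin_glb_lt; lra).
    assert (Hr1 : r <= d / 2) by apply Rmin_l. assert (Hr2 : r <= (be - al) / 4) by apply Rmin_r.
    assert (Hx : exists x, Rabs (x - e) < d /\ I x = I m).
    { destruct He as [-> | ->].
      - exists (al + r). split; [apply Rabs_lt_between; lra |].
        apply Hin; unfold m; lra.
      - exists (be - r). split; [apply Rabs_lt_between; lra |].
        symmetry; apply Hin; unfold m; lra. }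
    destruct Hx as (x & Hxd & <-).
    specialize (Hc x Hxd). fold (I x) (I e) in Hc.
    rewrite Rabs_minus_sym. eapply Rle_lt_trans; [exact Hc |].
    replace ((b - a) * (eps / (b - a + 1))) with (eps - eps / (b - a + 1)) by (field; lra).
    assert (0 < eps / (b - a + 1)) by (apply Rdiv_lt_0_compat; lra). lra. }
  fold (I al) (I be). rewrite (E al), (E be); auto.
Qed.

(** * Complex differentiability and continuity in terms of the modulus *)

Lemma Cmod_le_Rabs (z : C) : Cmod z <= Rabs (Re z) + Rabs (Im z).
Proof.
  destruct z as [x y]. simpl.
  assert (Hx := Rabs_pos x). assert (Hy := Rabs_pos y).
  unfold Cmod; simpl. rewrite <- (sqrt_Rsqr (Rabs x + Rabs y)) by lra.
  apply sqrt_le_1_alt. unfold Rsqr.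
  assert (X := Rsqr_abs x). assert (Y := Rsqr_abs y). unfold Rsqr in X, Y. nra.
Qed.

Lemma Rabs_Re_le_Cmod (z : C) : Rabs (Re z) <= Cmod z.
Proof. eapply Rle_trans; [| apply Rmax_Cmod]. apply Rmax_l. Qed.

Lemma Rabs_Im_le_Cmod (z : C) : Rabs (Im z) <= Cmod z.
Proof. eapply Rle_trans; [| apply Rmax_Cmod]. apply Rmax_r. Qed.

(** Replaces the filters of Coquelicot by estimates with [Cmod], the form in which derivatives are
    checked and used here. *)
Lemma is_derive_C_eps (f : C -> C) (z l : C) :
  is_derive (K := C_AbsRing) (V := C_NormedModule) f z l <->
  forall eps, 0 < eps -> exists d, 0 < d /\ forall w, Cmod (w - z) < d ->
    Cmod (f w - f z - (w - z) * l) <= eps * Cmod (w - z).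
Proof.
  split.
  - intros [_ H] eps He.
    destruct (H z (fun P HP => HP) (mkposreal eps He)) as [d Hd].
    exists d; split; [apply cond_pos |]. intros w Hw. exact (Hd w Hw).
  - intros H. split; [apply is_linear_scal_l |].
    intros x Hx.
    apply (is_filter_lim_locally_unique (V := AbsRing_NormedModule C_AbsRing)) in Hx.
    subst x. intros eps.
    destruct (H eps (cond_pos eps)) as (d & Hd & Hw). exists (mkposreal d Hd). exact Hw.
Qed.

Lemma continuous_on_eps (S : C -> Prop) (f : C -> C) (z : C) :
  filterlim f (within S (locally z)) (locally (f z)) <->
  forall eps, 0 < eps -> exists d, 0 < d /\
    forall w, S w -> Cmod (w - z) < d -> Cmod (f w - f z) < eps.
Proof.
  split.
  - intros H eps He.
    destruct (H (fun v => Cmod (v - f z) < eps)) as [d Hd].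
    + apply locally_C. exists (mkposreal eps He). intros y Hy; exact Hy.
    + exists d; split; [apply cond_pos |]. intros w Hw Hwd. apply Hd; [| exact Hw].
      apply C_NormedModule_mixin_compat1. exact Hwd.
  - intros H Q HQ. apply locally_C in HQ. destruct HQ as [eps HQ].
    destruct (H eps (cond_pos eps)) as (d & Hd & Hw).
    apply (proj2 (locally_C z (fun w => S w -> Q (f w)))).
    exists (mkposreal d Hd). intros w Hwd HS. apply HQ, Hw; [exact HS | exact Hwd].
Qed.

Definition closed_strip (al be : R) (z : C) : Prop := al <= Re z <= be.

(** Precomposing with [clamp] in the first coordinate extends a function from the closed strip to
    one that is continuous on the whole plane, as the real integration lemmas above require.
    Closedness is asked only inside the strip, where [clamp] is the identity. *)
Definition clamp (al be x : R) : R := Rmax al (Rmin x be).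

Lemma clamp_bounds (al be x : R) : al <= be -> al <= clamp al be x <= be.
Proof.
  intros H. unfold clamp. split; [apply Rmax_l |].
  apply Rmax_lub; [exact H | apply Rmin_r].
Qed.

Lemma clamp_id (al be x : R) : al <= x <= be -> clamp al be x = x.
Proof. intros H. unfold clamp. rewrite Rmin_left, Rmax_right; lra. Qed.

Lemma clamp_lipschitz (al be x x' : R) :
  al <= be -> Rabs (clamp al be x - clamp al be x') <= Rabs (x - x').
Proof.
  intros H. unfold clamp, Rmax, Rmin.
  repeat (destruct Rle_dec); unfold Rabs; repeat (destruct Rcase_abs); lra.
Qed.

Lemma continuity_2d_clamped (Phi : C -> C) (al be : R) :
  al <= be -> continuous_on (closed_strip al be) Phi ->
  forall x y, continuity_2d_pt (fun x y => Re (Phi (clamp al be x, y))) x y /\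
              continuity_2d_pt (fun x y => Im (Phi (clamp al be x, y))) x y.
Proof.
  intros Hab HC x y.
  assert (K : forall eps, 0 < eps -> exists d, 0 < d /\
    forall u v, Rabs (u - x) < d -> Rabs (v - y) < d ->
      Cmod (Phi (clamp al be u, v) - Phi (clamp al be x, y)) < eps).
  { intros eps He.
    destruct (proj1 (continuous_on_eps _ _ _)
      (HC (clamp al be x, y) (clamp_bounds al be x Hab)) eps He) as (d & Hd & Hw).
    exists (d / 2); split; [lra |]. intros u v Hu Hv.
    apply Hw; [apply clamp_bounds; exact Hab |].
    eapply Rle_lt_trans; [apply Cmod_le_Rabs |]. simpl.
    assert (L := clamp_lipschitz al be u x Hab). unfold Rminus in *. lra. }
  split; intros eps; destruct (K eps (cond_pos eps)) as (d & Hd & Hk);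
    exists (mkposreal d Hd); intros u v Hu Hv; specialize (Hk u v Hu Hv).
  - eapply Rle_lt_trans; [| exact Hk].
    apply (Rabs_Re_le_Cmod (Phi (clamp al be u, v) - Phi (clamp al be x, y))).
  - eapply Rle_lt_trans; [| exact Hk].
    apply (Rabs_Im_le_Cmod (Phi (clamp al be u, v) - Phi (clamp al be x, y))).
Qed.

Lemma continuous_strip_slice (F : C -> C) (al be x : R) :
  al <= x <= be -> continuous_on (closed_strip al be) F ->
  (forall y, continuous (fun t => Re (F (x, t))) y) /\
  (forall y, continuous (fun t => Im (F (x, t))) y).
Proof.
  intros Hx HF.
  assert (K := continuity_2d_clamped F al be ltac:(lra) HF).
  split; intros y.
  - apply (continuous_ext (fun t => Re (F (clamp al be x, t)))).
    + intros t. rewrite clamp_id by lra. reflexivity.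
    + apply (continuous_slice2 (fun x y => Re (F (clamp al be x, y)))). intros; apply K.
  - apply (continuous_ext (fun t => Im (F (clamp al be x, t)))).
    + intros t. rewrite clamp_id by lra. reflexivity.
    + apply (continuous_slice2 (fun x y => Im (F (clamp al be x, y)))). intros; apply K.
Qed.

(* The Cauchy-Riemann equations say that the real and imaginary parts
   [u dx - v dy] and [v dx + u dy] of [(u + i v) dz] are closed. *)
Lemma closed_at_clamped (Phi : C -> C) (al be x y : R) :
  al < x < be -> C_differentiable Phi (x, y) ->
  closed_at (fun x y => Im (Phi (clamp al be x, y))) (fun x y => Re (Phi (clamp al be x, y))) x y /\
  closed_at (fun x y => Re (Phi (clamp al be x, y))) (fun x y => - Im (Phi (clamp al be x, y))) x y.
Proof.
  intros Hx [[p q] HD].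
  assert (K : forall eps, 0 < eps -> exists d, 0 < d /\
    forall u v, Rabs (u - x) < d -> Rabs (v - y) < d ->
      Rabs (Re (Phi (clamp al be u, v)) - Re (Phi (clamp al be x, y)) - p * (u - x) - - q * (v - y))
        <= eps * (Rabs (u - x) + Rabs (v - y)) /\
      Rabs (Im (Phi (clamp al be u, v)) - Im (Phi (clamp al be x, y)) - q * (u - x) - p * (v - y))
        <= eps * (Rabs (u - x) + Rabs (v - y))).
  { intros eps He.
    destruct (proj1 (is_derive_C_eps _ _ _) HD eps He) as (d & Hd & Hw).
    set (r := Rmin (d / 2) (Rmin (x - al) (be - x))).
    assert (Hr : 0 < r) by (repeat apply Rmin_glb_lt; lra).
    assert (R1 : r <= d / 2) by apply Rmin_l.
    assert (R2 : r <= x - al) by (eapply Rle_trans; [apply Rmin_r | apply Rmin_l]).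
    assert (R3 : r <= be - x) by (eapply Rle_trans; [apply Rmin_r | apply Rmin_r]).
    exists r; split; [exact Hr |]. intros u v Hu Hv.
    assert (Hu' := Hu). apply Rabs_lt_between in Hu'.
    rewrite !clamp_id by lra.
    assert (N : Cmod ((u, v) - (x, y)) <= Rabs (u - x) + Rabs (v - y))
      by apply (Cmod_le_Rabs ((u, v) - (x, y))).
    specialize (Hw (u, v) ltac:(lra)).
    assert (M : eps * Cmod ((u, v) - (x, y)) <= eps * (Rabs (u - x) + Rabs (v - y)))
      by (apply Rmult_le_compat_l; lra).
    assert (B := Rle_trans _ _ _ Hw M).
    split; (eapply Rle_trans; [| exact B]).
    - eapply Rle_trans; [| apply Rabs_Re_le_Cmod]. right. f_equal.
      destruct (Phi (u, v)), (Phi (x, y)). simpl. ring.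
    - eapply Rle_trans; [| apply Rabs_Im_le_Cmod]. right. f_equal.
      destruct (Phi (u, v)), (Phi (x, y)). simpl. ring. }
  split.
  - exists q, p, (- q). intros eps He. destruct (K eps He) as (d & Hd & Hk).
    exists d; split; [exact Hd |]. intros u v Hu Hv. destruct (Hk u v Hu Hv). split; assumption.
  - exists p, (- q), (- p). intros eps He. destruct (K eps He) as (d & Hd & Hk).
    exists d; split; [exact Hd |]. intros u v Hu Hv. destruct (Hk u v Hu Hv) as [A B].
    split; [exact A |]. rewrite <- Rabs_Ropp.
    refine (Rle_trans _ _ _ _ B). right. f_equal. ring.
Qed.

(** The two closed forms are the imaginary and the real part of [Phi dz]. Along a vertical line
    [dz = i dy], so the first yields the integral of [Re Phi] and the second that of [- Im Phi]. *)
Lemma RInt_strip_invariant (Phi : C -> C) (al be a b : R) :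
  al < be -> a <= b ->
  continuous_on (closed_strip al be) Phi ->
  (forall z, al < Re z < be -> C_differentiable Phi z) ->
  (forall x, al <= x <= be -> Phi (x, a) = Phi (x, b)) ->
  RInt (fun y => Re (Phi (al, y))) a b = RInt (fun y => Re (Phi (be, y))) a b /\
  RInt (fun y => Im (Phi (al, y))) a b = RInt (fun y => Im (Phi (be, y))) a b.
Proof.
  intros Hs Hab HC HD Hper.
  assert (K := continuity_2d_clamped Phi al be (Rlt_le _ _ Hs) HC).
  assert (E1 : clamp al be al = al) by (apply clamp_id; lra).
  assert (E2 : clamp al be be = be) by (apply clamp_id; lra).
  split.
  - assert (H := closed_form_strip (fun x y => Im (Phi (clamp al be x, y)))
      (fun x y => Re (Phi (clamp al be x, y))) al be a b Hs Hab).
    simpl in H. rewrite E1, E2 in H. apply H.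
    + intros x y. apply K.
    + intros x y. apply K.
    + intros x. f_equal. apply Hper, clamp_bounds; lra.
    + intros x y Hx. apply closed_at_clamped; [exact Hx |]. apply HD; exact Hx.
  - assert (H := closed_form_strip (fun x y => Re (Phi (clamp al be x, y)))
      (fun x y => - Im (Phi (clamp al be x, y))) al be a b Hs Hab).
    simpl in H. rewrite E1, E2 in H.
    assert (X : forall c, al <= c <= be ->
      RInt (fun t => - Im (Phi (c, t))) a b = - RInt (fun t => Im (Phi (c, t))) a b).
    { intros c Hc. apply (RInt_opp (V := R_CompleteNormedModule) (fun t => Im (Phi (c, t)))).
      apply ex_RInt_continuous_everywhere.
      exact (proj2 (continuous_strip_slice Phi al be c Hc HC)). }
    rewrite !X in H by lra. apply Ropp_eq_reg, H.
    + intros x y. apply K.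
    + intros x y. apply continuity_2d_pt_opp. apply K.
    + intros x. f_equal. apply Hper, clamp_bounds; lra.
    + intros x y Hx. apply closed_at_clamped; [exact Hx |]. apply HD; exact Hx.
Qed.

(** * Uniqueness of Fourier coefficients *)

(* [RInt] equations live in [CompleteNormedModule.sort _], which [ring] does not see as [R]. *)
Ltac ring_R := match goal with |- ?a = ?b => change (@eq R a b) end; ring.

Lemma continuous_Rmult (h k : R -> R) (t : R) :
  continuous h t -> continuous k t -> continuous (fun s => h s * k s) t.
Proof. intros H K. apply (continuous_mult (K := R_AbsRing)); assumption. Qed.

Lemma continuous_cos_mul (l : R) (t : R) : continuous (fun s => cos (l * s)) t.
Proof. apply (ex_derive_continuous (V := R_NormedModule)). auto_derive. exact I. Qed.

Lemma continuous_sin_mul (l : R) (t : R) : continuous (fun s => sin (l * s)) t.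
Proof. apply (ex_derive_continuous (V := R_NormedModule)). auto_derive. exact I. Qed.

Lemma RInt_lin2 (h k : R -> R) (p q a b : R) :
  (forall t, continuous h t) -> (forall t, continuous k t) ->
  RInt (fun t => p * h t + q * k t) a b = p * RInt h a b + q * RInt k a b.
Proof.
  intros Hh Hk.
  assert (A := ex_RInt_continuous_everywhere h a b Hh).
  assert (B := ex_RInt_continuous_everywhere k a b Hk).
  transitivity (plus (RInt (fun t => scal p (h t)) a b) (RInt (fun t => scal q (k t)) a b)).
  - apply (RInt_plus (V := R_CompleteNormedModule));
      apply (ex_RInt_scal (V := R_NormedModule)); assumption.
  - rewrite !(RInt_scal (V := R_CompleteNormedModule)) by assumption. reflexivity.
Qed.

(** Equal to the square of cos ((t - t0) / 2). Up to normalisation its N-th power is the de la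
    Vallee Poussin kernel: a nonnegative trigonometric polynomial of degree N with its maximum at
    [t0]. *)
Definition peak (t0 t : R) : R := (1 + cos (t - t0)) / 2.

Lemma continuous_peak_pow (t0 : R) (N : nat) (t : R) : continuous (fun s => peak t0 s ^ N) t.
Proof. apply (ex_derive_continuous (V := R_NormedModule)). unfold peak. auto_derive. exact I. Qed.

Lemma peak_bounds (t0 t : R) : 0 <= peak t0 t <= 1.
Proof. unfold peak. assert (H := COS_bound (t - t0)). lra. Qed.

Definition fourier_null (h : R -> R) : Prop := forall n : nat,
  RInt (fun t => h t * cos (INR n * t)) (- PI) PI = 0 /\
  RInt (fun t => h t * sin (INR n * t)) (- PI) PI = 0.

(** Multiplication by [peak] shifts a frequency by one in both directions, so the induction below
    has to run over all integers. *)
Lemma fourier_null_Z (h : R -> R) (n : Z) :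
  (forall t, continuous h t) -> fourier_null h ->
  RInt (fun t => h t * cos (IZR n * t)) (- PI) PI = 0 /\
  RInt (fun t => h t * sin (IZR n * t)) (- PI) PI = 0.
Proof.
  intros h_cont h_null.
  destruct (Z_le_gt_dec 0 n) as [Hn | Hn].
  - rewrite <- (Z2Nat.id n Hn), <- INR_IZR_INZ. apply h_null.
  - replace (IZR n) with (- INR (Z.to_nat (- n)))
      by (rewrite INR_IZR_INZ, Z2Nat.id, opp_IZR by lia; ring).
    set (m := Z.to_nat (- n)). split.
    + rewrite <- (proj1 (h_null m)). apply RInt_ext. intros t _.
      rewrite Ropp_mult_distr_l_reverse, cos_neg. reflexivity.
    + rewrite (RInt_ext _ (fun t => (-1) * (h t * sin (INR m * t)) + 0 * h t)).
      * rewrite RInt_lin2, (proj2 (h_null m)); [ring_R | | exact h_cont].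
        intros t. apply continuous_Rmult; [apply h_cont | apply continuous_sin_mul].
      * intros t _. rewrite Ropp_mult_distr_l_reverse, sin_neg. ring_R.
Qed.

(** Induction on N for all n at once: by the product formulas, [peak t0 t] times a wave of frequency
    n is a combination of waves of frequencies n - 1, n and n + 1. *)
Lemma fourier_null_peak (h : R -> R) (t0 : R) (N : nat) :
  (forall t, continuous h t) -> fourier_null h -> forall n : Z,
  RInt (fun t => h t * peak t0 t ^ N * cos (IZR n * t)) (- PI) PI = 0 /\
  RInt (fun t => h t * peak t0 t ^ N * sin (IZR n * t)) (- PI) PI = 0.
Proof.
  intros h_cont h_null.
  induction N as [| N IH]; intros n.
  - destruct (fourier_null_Z h n h_cont h_null) as [A B]. split.
    + rewrite <- A. apply RInt_ext. intros t _. simpl. ring_R.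
    + rewrite <- B. apply RInt_ext. intros t _. simpl. ring_R.
  - set (k := fun t => h t * peak t0 t ^ N).
    assert (IHk : forall n, RInt (fun t => k t * cos (IZR n * t)) (- PI) PI = 0 /\
      RInt (fun t => k t * sin (IZR n * t)) (- PI) PI = 0) by exact IH.
    assert (kc : forall l t, continuous (fun t => k t * cos (l * t)) t).
    { intros l t. apply continuous_Rmult; [| apply continuous_cos_mul].
      apply continuous_Rmult; [apply h_cont | apply continuous_peak_pow]. }
    assert (ks : forall l t, continuous (fun t => k t * sin (l * t)) t).
    { intros l t. apply continuous_Rmult; [| apply continuous_sin_mul].
      apply continuous_Rmult; [apply h_cont | apply continuous_peak_pow]. }
    assert (lin_cont : forall p q u v, (forall t, continuous u t) -> (forall t, continuous v t) ->
      forall t : R, continuous (fun t : R => p * u t + q * v t) t).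
    { intros p q u v Hu Hv t. apply (continuous_plus (V := R_NormedModule));
        apply continuous_Rmult; auto; apply continuous_const. }
    destruct (IHk n) as [A0 B0]. destruct (IHk (n + 1)%Z) as [A1 B1].
    destruct (IHk (n - 1)%Z) as [A2 B2].
    rewrite plus_IZR in A1, B1. rewrite minus_IZR in A2, B2.
    split.
    (* The nesting and the factors 1 give the sum the shape [p * h t + q * k t] at every level, so
       that [RInt_lin2] splits it by rewriting. *)
    + rewrite (RInt_ext _ (fun t => 1 * (1 / 2 * (k t * cos (IZR n * t)) +
          cos t0 / 4 * (k t * cos ((IZR n + 1) * t))) + 1 * (sin t0 / 4 * (k t * sin ((IZR n + 1) * t)) +
          1 * (cos t0 / 4 * (k t * cos ((IZR n - 1) * t)) + - sin t0 / 4 * (k t * sin ((IZR n - 1) * t)))))).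
      * rewrite !RInt_lin2; auto. rewrite A0, A1, A2, B1, B2. ring_R.
      * intros t _. unfold k, peak.
        replace ((IZR n + 1) * t) with (IZR n * t + t) by ring.
        replace ((IZR n - 1) * t) with (IZR n * t - t) by ring.
        rewrite !cos_minus, !sin_minus, !cos_plus, !sin_plus. simpl. field.
    + rewrite (RInt_ext _ (fun t => 1 * (1 / 2 * (k t * sin (IZR n * t)) +
          cos t0 / 4 * (k t * sin ((IZR n + 1) * t))) + 1 * (- sin t0 / 4 * (k t * cos ((IZR n + 1) * t)) +
          1 * (cos t0 / 4 * (k t * sin ((IZR n - 1) * t)) + sin t0 / 4 * (k t * cos ((IZR n - 1) * t)))))).
      * rewrite !RInt_lin2; auto. rewrite B0, A1, A2, B1, B2. ring_R.
      * intros t _. unfold k, peak.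
        replace ((IZR n + 1) * t) with (IZR n * t + t) by ring.
        replace ((IZR n - 1) * t) with (IZR n * t - t) by ring.
        rewrite !cos_minus, !sin_minus, !cos_plus, !sin_plus. simpl. field.
Qed.

Lemma fourier_null_peak_moment (h : R -> R) (t0 : R) (N : nat) :
  (forall t, continuous h t) -> fourier_null h ->
  RInt (fun t => h t * peak t0 t ^ N) (- PI) PI = 0.
Proof.
  intros h_cont h_null.
  destruct (fourier_null_peak h t0 N h_cont h_null 0) as [A _]. rewrite <- A. apply RInt_ext.
  intros t _. rewrite Rmult_0_l, cos_0. ring_R.
Qed.


(** The upper bound on the distance accounts for periodicity: the cosine grows again past PI, and
    [2 * PI - d] mirrors [d]. *)
Lemma peak_le (t0 t d : R) :
  0 <= d <= PI -> d <= Rabs (t - t0) <= 2 * PI - d -> peak t0 t <= (1 + cos d) / 2.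
Proof.
  intros Hd Ht. unfold peak.
  replace (cos (t - t0)) with (cos (Rabs (t - t0)))
    by (unfold Rabs; destruct Rcase_abs; rewrite ?cos_neg; reflexivity).
  set (s := Rabs (t - t0)) in *.
  assert (cos s <= cos d); [| lra].
  destruct (Rle_dec s PI).
  - apply cos_decr_1; lra.
  - replace (cos s) with (cos (2 * PI - s))
      by (rewrite cos_minus, cos_2PI, sin_2PI; ring).
    apply cos_decr_1; lra.
Qed.

Lemma peak_ge (t0 t d : R) :
  0 <= d <= PI -> Rabs (t - t0) <= d -> (1 + cos d) / 2 <= peak t0 t.
Proof.
  intros Hd Ht. unfold peak.
  replace (cos (t - t0)) with (cos (Rabs (t - t0)))
    by (unfold Rabs; destruct Rcase_abs; rewrite ?cos_neg; reflexivity).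
  assert (H := Rabs_pos (t - t0)). set (s := Rabs (t - t0)) in *.
  assert (cos d <= cos s); [| lra].
  apply cos_decr_1; lra.
Qed.

Lemma RInt_ge_const (k : R -> R) (a b c : R) :
  a <= b -> (forall t, continuous k t) -> (forall t, a <= t <= b -> c <= k t) ->
  (b - a) * c <= RInt k a b.
Proof.
  intros Hab Hk Hc.
  replace ((b - a) * c) with (RInt (fun _ : R => c) a b) by (rewrite RInt_const; reflexivity).
  apply RInt_le; [exact Hab | apply (ex_RInt_const (V := R_NormedModule))
    | apply ex_RInt_continuous_everywhere; exact Hk | intros t Ht; apply Hc; lra].
Qed.

Lemma bounded_on_segment (h : R -> R) (a b : R) :
  (forall t, continuous h t) -> exists M, 0 < M /\ forall t, a <= t <= b -> Rabs (h t) <= M.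
Proof.
  intros Hc. destruct (Rle_dec a b) as [Hab | Hab].
  - destruct (continuity_ab_maj (fun t => Rabs (h t)) a b Hab) as (m & Hm & _).
    + intros t _. apply continuity_pt_filterlim.
      apply (continuous_comp h Rabs); [apply Hc | apply continuous_Rabs].
    + exists (Rabs (h m) + 1). split; [assert (H := Rabs_pos (h m)); lra |].
      intros t Ht. specialize (Hm t Ht). simpl in Hm. lra.
  - exists 1. split; [lra |]. intros t Ht. lra.
Qed.

(* The kernels [peak t0 ^ N] concentrate at [t0]: near [t0] they are at least [k1 ^ N],
   away from it at most [k2 ^ N] with [k2 < k1]. *)
Lemma fourier_null_not_pos (h : R -> R) (t0 : R) :
  (forall t, continuous h t) -> fourier_null h -> - PI < t0 < PI -> ~ 0 < h t0.
Proof.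
  intros Hc Hn Ht0 Hpos.
  assert (PI_pos := PI_RGT_0).
  destruct (proj2 (continuity_pt_filterlim h t0) (Hc t0) (h t0 / 2)) as (d0 & Hd0 & Hd); [lra |].
  simpl in Hd. unfold Rdist in Hd.
  (* Keeps [[t0 - d, t0 + d]] inside the period, with [h] at least [h t0 / 2] on it, and every point
     of the period within [2 * PI - d] of [t0], as [peak_le] demands. *)
  set (d := Rmin (d0 / 2) (Rmin ((t0 + PI) / 2) ((PI - t0) / 2))).
  assert (D0 : 0 < d) by (repeat apply Rmin_glb_lt; lra).
  assert (D1 : d <= d0 / 2) by apply Rmin_l.
  assert (D2 : d <= (t0 + PI) / 2) by (eapply Rle_trans; [apply Rmin_r | apply Rmin_l]).
  assert (D3 : d <= (PI - t0) / 2) by (eapply Rle_trans; [apply Rmin_r | apply Rmin_r]).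
  assert (near : forall t, Rabs (t - t0) <= d -> h t0 / 2 <= h t).
  { intros t Ht. destruct (Req_dec t t0) as [-> | E]; [lra |].
    assert (A : Rabs (h t - h t0) < h t0 / 2).
    { apply Hd. split; [split; [exact I | auto] | lra]. }
    apply Rabs_lt_between in A. lra. }
  destruct (bounded_on_segment h (- PI) PI Hc) as (M & HM & HMb).
  set (k1 := (1 + cos (d / 2)) / 2). set (k2 := (1 + cos d) / 2).
  assert (K12 : k2 < k1).
  { unfold k1, k2. assert (cos d < cos (d / 2)) by (apply cos_decreasing_1; lra). lra. }
  assert (K2 : 0 <= k2) by (unfold k2; assert (H := COS_bound d); lra).
  (* The integral of [h * peak ^ N] is zero. The interval of radius d / 2 contributes at least the
     left side, the rest of the interval of radius d is nonnegative, and the points beyond can take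
     away at most the right side. *)
  assert (key : forall N, d * (h t0 / 2 * k1 ^ N) <= 2 * PI * (M * k2 ^ N)).
  { intros N.
    set (k := fun t => h t * peak t0 t ^ N).
    assert (kc : forall t, continuous k t).
    { intros t. apply continuous_Rmult; auto using continuous_peak_pow. }
    assert (Z : RInt k (- PI) PI = 0) by (apply fourier_null_peak_moment; assumption).
    assert (S : RInt k (- PI) PI = RInt k (- PI) (t0 - d) + (RInt k (t0 - d) (t0 - d / 2) +
      (RInt k (t0 - d / 2) (t0 + d / 2) + (RInt k (t0 + d / 2) (t0 + d) + RInt k (t0 + d) PI)))).
    { rewrite (RInt_Chasles_continuous k _ (t0 - d)) by exact kc. f_equal.
      rewrite (RInt_Chasles_continuous k _ (t0 - d / 2)) by exact kc. f_equal.
      rewrite (RInt_Chasles_continuous k _ (t0 + d / 2)) by exact kc. f_equal.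
      apply RInt_Chasles_continuous, kc. }
    assert (pk : forall t, 0 <= peak t0 t ^ N) by (intros t; apply pow_le, peak_bounds).
    assert (far : forall t, - PI <= t <= PI -> d <= Rabs (t - t0) -> - (M * k2 ^ N) <= k t).
    { intros t Ht Htd. unfold k.
      assert (A : peak t0 t ^ N <= k2 ^ N).
      { apply pow_incr. split; [apply peak_bounds |]. apply peak_le; [lra |]. split; [exact Htd |].
        apply Rabs_le; lra. }
      specialize (HMb t Ht). apply Rabs_le_between in HMb. specialize (pk t). nra. }
    assert (I1 : (t0 - d - - PI) * - (M * k2 ^ N) <= RInt k (- PI) (t0 - d)).
    { apply RInt_ge_const; [lra | exact kc |]. intros t Ht. apply far; [lra |].
      rewrite Rabs_left1; lra. }
    assert (I5 : (PI - (t0 + d)) * - (M * k2 ^ N) <= RInt k (t0 + d) PI).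
    { apply RInt_ge_const; [lra | exact kc |]. intros t Ht. apply far; [lra |].
      rewrite Rabs_pos_eq; lra. }
    assert (I2 : (t0 - d / 2 - (t0 - d)) * 0 <= RInt k (t0 - d) (t0 - d / 2)).
    { apply RInt_ge_const; [lra | exact kc |]. intros t Ht. unfold k.
      apply Rmult_le_pos; [| apply pk]. assert (h t0 / 2 <= h t) by (apply near, Rabs_le; lra). lra. }
    assert (I4 : (t0 + d - (t0 + d / 2)) * 0 <= RInt k (t0 + d / 2) (t0 + d)).
    { apply RInt_ge_const; [lra | exact kc |]. intros t Ht. unfold k.
      apply Rmult_le_pos; [| apply pk]. assert (h t0 / 2 <= h t) by (apply near, Rabs_le; lra). lra. }
    assert (I3 : (t0 + d / 2 - (t0 - d / 2)) * (h t0 / 2 * k1 ^ N) <= RInt k (t0 - d / 2) (t0 + d / 2)).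
    { apply RInt_ge_const; [lra | exact kc |]. intros t Ht. unfold k.
      apply Rmult_le_compat; [lra | apply pow_le; lra | apply near, Rabs_le; lra |].
      apply pow_incr. split; [lra |]. apply peak_ge; [lra | apply Rabs_le; lra]. }
    assert (0 <= M * k2 ^ N) by (apply Rmult_le_pos; [lra | apply pow_le; lra]).
    nra. }
  (* Dividing [key] by [k1 ^ N] bounds a fixed positive number by a multiple of [q ^ N], which is
     false for large N. *)
  set (q := k2 / k1).
  assert (Hq : 0 <= q < 1).
  { unfold q. split; [apply Rdiv_le_0_compat; lra |]. apply Rlt_div_l; lra. }
  set (e := d * (h t0 / 2) / (2 * PI * M)).
  assert (PM : 0 < 2 * PI * M) by (apply Rmult_lt_0_compat; lra).
  assert (He : 0 < e) by (apply Rdiv_lt_0_compat; [apply Rmult_lt_0_compat; lra | exact PM]).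
  destruct (pow_lt_1_zero q) with (y := e) as [N HN]; [rewrite Rabs_pos_eq; lra | exact He |].
  specialize (HN N (le_n N)). rewrite Rabs_pos_eq in HN by (apply pow_le; lra).
  specialize (key N).
  assert (k1p : 0 < k1 ^ N) by (apply pow_lt; lra).
  replace (k2 ^ N) with (q ^ N * k1 ^ N) in key
    by (unfold q; rewrite <- Rpow_mult_distr; f_equal; field; lra).
  assert (F : d * (h t0 / 2) = e * (2 * PI * M)) by (unfold e; field; split; lra).
  assert (e * (2 * PI * M) <= q ^ N * (2 * PI * M)).
  { rewrite <- F. apply Rmult_le_reg_r with (k1 ^ N); [exact k1p |]. lra. }
  apply Rmult_le_reg_r in H; lra.
Qed.

(** At inner points both [h] and [- h] fail to be positive; the two endpoints follow by
    continuity. *)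
Lemma fourier_null_zero (h : R -> R) :
  (forall t, continuous h t) -> fourier_null h -> forall t, - PI <= t <= PI -> h t = 0.
Proof.
  intros Hc Hn.
  assert (Hc' : forall t, continuous (fun s => - h s) t).
  { intros t. apply (continuous_opp (V := R_NormedModule) h). apply Hc. }
  assert (Hn' : fourier_null (fun s => - h s)).
  { intros n. destruct (Hn n) as [A B]. split.
    - rewrite (RInt_ext _ (fun t => -1 * (h t * cos (INR n * t)) + 0 * h t)) by (intros; ring_R).
      rewrite RInt_lin2, A; [ring_R | | exact Hc].
      intros t; apply continuous_Rmult; auto using continuous_cos_mul.
    - rewrite (RInt_ext _ (fun t => -1 * (h t * sin (INR n * t)) + 0 * h t)) by (intros; ring_R).
      rewrite RInt_lin2, B; [ring_R | | exact Hc].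
      intros t; apply continuous_Rmult; auto using continuous_sin_mul. }
  assert (inner : forall t, - PI < t < PI -> h t = 0).
  { intros t Ht.
    assert (A := fourier_null_not_pos h t Hc Hn Ht).
    assert (B := fourier_null_not_pos _ t Hc' Hn' Ht). simpl in B. lra. }
  intros t Ht. assert (PI_pos := PI_RGT_0).
  apply Req_lt_aux. intros [eps Heps]. simpl.
  destruct (proj2 (continuity_pt_filterlim h t) (Hc t) eps Heps) as (d & Hd & Hdd).
  simpl in Hdd. unfold Rdist in Hdd.
  set (r := Rmin (d / 2) (PI / 2)).
  assert (R0 : 0 < r) by (apply Rmin_glb_lt; lra).
  assert (R1 : r <= d / 2) by apply Rmin_l. assert (R2 : r <= PI / 2) by apply Rmin_r.
  assert (S : exists s, - PI < s < PI /\ s <> t /\ Rabs (s - t) < d).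
  { destruct (Rle_dec t 0).
    - exists (t + r). split; [lra | split; [lra | apply Rabs_lt_between; lra]].
    - exists (t - r). split; [lra | split; [lra | apply Rabs_lt_between; lra]]. }
  destruct S as (s & Hs & Est & Hsd).
  assert (A : Rabs (h s - h t) < eps) by (apply Hdd; split; [split; [exact I | auto] | exact Hsd]).
  rewrite (inner s Hs) in A. rewrite Rabs_minus_sym in A. rewrite !Rminus_0_r in *. exact A.
Qed.

(** * The complex exponential and exponential moments *)

(* [C_NormedModule] and [AbsRing_NormedModule C_AbsRing] carry different uniform structures;
   the product and chain rules of Coquelicot use the latter. *)
Lemma is_derive_C_AbsRing (f : C -> C) (z l : C) :
  is_derive (K := C_AbsRing) (V := C_NormedModule) f z l <->
  is_derive (K := C_AbsRing) (V := AbsRing_NormedModule C_AbsRing) f z l.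
Proof. split; intros [_ H]; (split; [apply is_linear_scal_l | exact H]). Qed.

Lemma C_differentiable_comp (f g : C -> C) (z : C) :
  C_differentiable f (g z) -> C_differentiable g z -> C_differentiable (fun w => f (g w)) z.
Proof.
  intros [lf Hf] [lg Hg]. eexists. apply is_derive_comp; [exact Hf |].
  apply is_derive_C_AbsRing; exact Hg.
Qed.

Lemma C_differentiable_mult (f g : C -> C) (z : C) :
  C_differentiable f z -> C_differentiable g z -> C_differentiable (fun w => f w * g w)%C z.
Proof.
  intros [lf Hf] [lg Hg]. eexists. apply is_derive_C_AbsRing.
  apply (is_derive_mult (K := C_AbsRing) f g);
    [apply is_derive_C_AbsRing; exact Hf | apply is_derive_C_AbsRing; exact Hg | exact Cmult_comm].
Qed.

Lemma C_differentiable_plus (f g : C -> C) (z : C) :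
  C_differentiable f z -> C_differentiable g z -> C_differentiable (fun w => f w + g w)%C z.
Proof. intros Hf Hg. apply (ex_derive_plus (V := C_NormedModule) f g); assumption. Qed.

Lemma C_differentiable_const (a z : C) : C_differentiable (fun _ => a) z.
Proof. apply ex_derive_const. Qed.

Lemma C_differentiable_scal (a : C) (f : C -> C) (z : C) :
  C_differentiable f z -> C_differentiable (fun w => a * f w)%C z.
Proof. intros Hf. apply C_differentiable_mult; [apply C_differentiable_const | exact Hf]. Qed.

Lemma C_differentiable_id (z : C) : C_differentiable (fun w => w) z.
Proof. exists (@one C_AbsRing). apply is_derive_C_AbsRing. exact (is_derive_id (K := C_AbsRing) z). Qed.

Lemma C_differentiable_continuous_within (f : C -> C) (S : C -> Prop) (z : C) :
  C_differentiable f z -> filterlim f (within S (locally z)) (locally (f z)).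
Proof.
  intros Hf Q HQ.
  apply (proj2 (locally_C z (fun w => S w -> Q (f w)))).
  assert (H := ex_derive_continuous f z Hf Q HQ).
  destruct H as [d Hd]. exists d. intros w Hw _. exact (Hd w Hw).
Qed.

Definition cexp (u : C) : C := (exp (Re u) * cos (Im u), exp (Re u) * sin (Im u)).

Lemma cexp_plus (u v : C) : cexp (u + v) = (cexp u * cexp v)%C.
Proof.
  destruct u as [x y], v as [x' y']. unfold cexp, Cmult, Cplus; simpl.
  rewrite exp_plus, cos_plus, sin_plus. f_equal; ring.
Qed.

Lemma Cmod_cexp (u : C) : Cmod (cexp u) = exp (Re u).
Proof.
  unfold Cmod, cexp; simpl.
  assert (T := sin2_cos2 (Im u)). unfold Rsqr in T.
  replace (_ + _) with (exp (Re u) * exp (Re u))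
    by (transitivity (exp (Re u) * exp (Re u) * (sin (Im u) * sin (Im u) + cos (Im u) * cos (Im u)));
        [rewrite T; ring | ring]).
  apply sqrt_square, Rlt_le, exp_pos.
Qed.

Lemma small_o_at_0 (f : R -> R) (l : R) :
  derivable_pt_lim f 0 l ->
  forall eps, 0 < eps -> exists d, 0 < d /\ forall x, Rabs x < d ->
    Rabs (f x - f 0 - l * x) <= eps * Rabs x.
Proof.
  intros H eps He. destruct (H eps He) as [d Hd].
  exists d; split; [apply cond_pos |]. intros x Hx.
  destruct (Req_dec x 0) as [-> | Hx0].
  - rewrite Rmult_0_r, Rminus_eq_0, Rminus_0_r, Rabs_R0. lra.
  - specialize (Hd x Hx0 Hx). rewrite Rplus_0_l in Hd.
    replace (f x - f 0 - l * x) with (((f x - f 0) / x - l) * x) by (field; exact Hx0).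
    rewrite Rabs_mult. apply Rmult_le_compat_r; [apply Rabs_pos | lra].
Qed.

(** This is the derivative of [cexp] at 0, assembled from those of exp, cos and sin; the addition
    formula moves it to any other point. *)
Lemma cexp_small_o (eps : R) : 0 < eps -> exists d, 0 < d /\ forall u, Cmod u < d ->
  Cmod (cexp u - 1 - u) <= eps * Cmod u.
Proof.
  intros He.
  destruct (small_o_at_0 exp 1 derivable_pt_lim_exp_0 (eps / 8)) as (d1 & D1 & E); [lra |].
  assert (Hcos : derivable_pt_lim cos 0 0)
    by (replace 0 with (- sin 0) at 2 by (rewrite sin_0; ring); apply derivable_pt_lim_cos).
  assert (Hsin : derivable_pt_lim sin 0 1)
    by (replace 1 with (cos 0) by apply cos_0; apply derivable_pt_lim_sin).
  destruct (small_o_at_0 cos 0 Hcos (eps / 8)) as (d2 & D2 & Co); [lra |].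
  destruct (small_o_at_0 sin 1 Hsin (eps / 8)) as (d3 & D3 & Si); [lra |].
  (* The five error terms cost 1, 2, 1, 2 and 1 times [eps / 8 * m], together less than [eps * m].
     The bound [eps / 8] on d handles the product [x * y], the bound 1 the factor [1 + x]. *)
  set (d := Rmin (Rmin 1 (eps / 8)) (Rmin d1 (Rmin d2 d3))).
  exists d. split; [repeat apply Rmin_glb_lt; lra |].
  assert (M0 : d <= 1) by (eapply Rle_trans; [apply Rmin_l | apply Rmin_l]).
  assert (M0' : d <= eps / 8) by (eapply Rle_trans; [apply Rmin_l | apply Rmin_r]).
  assert (M : d <= Rmin d1 (Rmin d2 d3)) by apply Rmin_r.
  assert (M1 := Rmin_l d1 (Rmin d2 d3)). assert (M2 := Rmin_r d1 (Rmin d2 d3)).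
  assert (M3 := Rmin_l d2 d3). assert (M4 := Rmin_r d2 d3).
  intros u Hu.
  assert (X := Rabs_Re_le_Cmod u). assert (Y := Rabs_Im_le_Cmod u).
  set (m := Cmod u) in *. destruct u as [x y]. simpl in X, Y.
  specialize (E x ltac:(lra)). specialize (Co y ltac:(lra)). specialize (Si y ltac:(lra)).
  rewrite exp_0 in E. rewrite cos_0 in Co. rewrite sin_0 in Si.
  assert (PX := Rabs_pos x). assert (PY := Rabs_pos y).
  assert (E' : Rabs (exp x - 1 - 1 * x) <= eps / 8 * m) by nra.
  assert (Co' : Rabs (cos y - 1 - 0 * y) <= eps / 8 * m) by nra.
  assert (Si' : Rabs (sin y - 0 - 1 * y) <= eps / 8 * m) by nra.
  clear E Co Si.
  assert (Cb : Rabs (cos y) <= 1) by (apply Rabs_le; assert (H := COS_bound y); lra).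
  assert (Sb : Rabs (sin y) <= 1) by (apply Rabs_le; assert (H := SIN_bound y); lra).
  assert (Xb : Rabs (1 + x) <= 2)
    by (eapply Rle_trans; [apply Rabs_triang |]; rewrite Rabs_R1; lra).
  eapply Rle_trans; [apply Cmod_le_Rabs |]. unfold cexp; simpl.
  replace (exp x * cos y + - (1) + - x)
    with ((exp x - 1 - 1 * x) * cos y + (1 + x) * (cos y - 1 - 0 * y)) by ring.
  replace (exp x * sin y + - 0 + - y)
    with ((exp x - 1 - 1 * x) * sin y + ((1 + x) * (sin y - 0 - 1 * y) + x * y)) by ring.
  assert (m0 : 0 <= m) by lra.
  assert (A1 : Rabs ((exp x - 1 - 1 * x) * cos y) <= eps / 8 * m * 1)
    by (rewrite Rabs_mult; apply Rmult_le_compat; auto using Rabs_pos).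
  assert (A2 : Rabs ((1 + x) * (cos y - 1 - 0 * y)) <= 2 * (eps / 8 * m))
    by (rewrite Rabs_mult; apply Rmult_le_compat; auto using Rabs_pos).
  assert (A3 : Rabs ((exp x - 1 - 1 * x) * sin y) <= eps / 8 * m * 1)
    by (rewrite Rabs_mult; apply Rmult_le_compat; auto using Rabs_pos).
  assert (A4 : Rabs ((1 + x) * (sin y - 0 - 1 * y)) <= 2 * (eps / 8 * m))
    by (rewrite Rabs_mult; apply Rmult_le_compat; auto using Rabs_pos).
  assert (A5 : Rabs (x * y) <= eps / 8 * m)
    by (rewrite Rabs_mult; apply Rmult_le_compat; auto using Rabs_pos; lra).
  assert (T1 := Rabs_triang ((exp x - 1 - 1 * x) * cos y) ((1 + x) * (cos y - 1 - 0 * y))).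
  assert (T2 := Rabs_triang ((exp x - 1 - 1 * x) * sin y) ((1 + x) * (sin y - 0 - 1 * y) + x * y)).
  assert (T3 := Rabs_triang ((1 + x) * (sin y - 0 - 1 * y)) (x * y)).
  assert (0 <= eps * m) by (apply Rmult_le_pos; lra).
  lra.
Qed.

Lemma C_differentiable_cexp (u : C) : C_differentiable cexp u.
Proof.
  exists (cexp u). apply is_derive_C_eps. intros eps He.
  assert (Hp := exp_pos (Re u)).
  destruct (cexp_small_o (eps / exp (Re u))) as (d & Hd & Hs); [apply Rdiv_lt_0_compat; lra |].
  exists d; split; [exact Hd |]. intros w Hw.
  replace (cexp w - cexp u - (w - u) * cexp u)%C
    with (cexp u * (cexp (w - u) - 1 - (w - u)))%C.
  - rewrite Cmod_mult, Cmod_cexp. specialize (Hs _ Hw).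
    apply (Rmult_le_compat_l (exp (Re u))) in Hs; [| lra].
    eapply Rle_trans; [exact Hs |]. right. field. lra.
  - assert (E : cexp w = (cexp u * cexp (w - u))%C)
      by (rewrite <- cexp_plus; f_equal; ring).
    rewrite E. ring.
Qed.

(** Written by real and imaginary parts, so that the ellipses x = const can be read off;
    [ccosh_cexp] supplies holomorphy. *)
Definition ccosh (u : C) : C := (cosh (Re u) * cos (Im u), sinh (Re u) * sin (Im u)).

Lemma ccosh_cexp (u : C) : ccosh u = (RtoC (/ 2) * (cexp u + cexp (RtoC (-1) * u)))%C.
Proof.
  destruct u as [x y]. unfold ccosh, cexp, cosh, sinh, Cmult, Cplus, RtoC; simpl.
  replace (-1 * x - 0 * y) with (- x) by ring. replace (-1 * y + 0 * x) with (- y) by ring.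
  rewrite cos_neg, sin_neg. f_equal; field.
Qed.

Lemma C_differentiable_ccosh (u : C) : C_differentiable ccosh u.
Proof.
  apply (ex_derive_ext (V := C_NormedModule)
    (fun u => RtoC (/ 2) * (cexp u + cexp (RtoC (-1) * u)))%C).
  - intros w. symmetry. apply ccosh_cexp.
  - apply C_differentiable_scal, C_differentiable_plus; [apply C_differentiable_cexp |].
    apply C_differentiable_comp; [apply C_differentiable_cexp |].
    apply C_differentiable_scal, C_differentiable_id.
Qed.

Lemma continuous_on_mult (S : C -> Prop) (f g : C -> C) :
  continuous_on S f -> continuous_on S g -> continuous_on S (fun w => f w * g w)%C.
Proof.
  intros Hf Hg z Hz. apply (continuous_on_eps S (fun w => f w * g w)%C). intros eps He.
  assert (Pf := Cmod_ge_0 (f z)). assert (Pg := Cmod_ge_0 (g z)).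
  set (ef := eps / (2 * (Cmod (g z) + 1))). set (eg := Rmin 1 (eps / (2 * (Cmod (f z) + 1)))).
  assert (Hef : 0 < ef) by (apply Rdiv_lt_0_compat; lra).
  assert (Heg : 0 < eg) by (apply Rmin_glb_lt; [lra | apply Rdiv_lt_0_compat; lra]).
  destruct (proj1 (continuous_on_eps _ _ _) (Hf z Hz) ef Hef) as (d1 & D1 & H1).
  destruct (proj1 (continuous_on_eps _ _ _) (Hg z Hz) eg Heg) as (d2 & D2 & H2).
  exists (Rmin d1 d2). split; [apply Rmin_glb_lt; lra |].
  intros w Hw Hd.
  specialize (H1 w Hw (Rlt_le_trans _ _ _ Hd (Rmin_l _ _))).
  specialize (H2 w Hw (Rlt_le_trans _ _ _ Hd (Rmin_r _ _))).
  assert (eg1 : eg <= 1) by apply Rmin_l.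
  assert (eg2 : eg <= eps / (2 * (Cmod (f z) + 1))) by apply Rmin_r.
  replace (f w * g w - f z * g z)%C
    with ((f w - f z) * (g z + (g w - g z)) + f z * (g w - g z))%C by ring.
  assert (T1 := Cmod_triangle ((f w - f z) * (g z + (g w - g z))) (f z * (g w - g z))).
  assert (T2 := Cmod_triangle (g z) (g w - g z)).
  rewrite !Cmod_mult in T1.
  assert (B1 : Cmod (f w - f z) * Cmod (g z + (g w - g z)) <= ef * (Cmod (g z) + 1))
    by (apply Rmult_le_compat; try apply Cmod_ge_0; lra).
  assert (B2 : Cmod (f z) * Cmod (g w - g z) < eps / 2).
  { apply Rle_lt_trans with (Cmod (f z) * (eps / (2 * (Cmod (f z) + 1)))).
    - apply Rmult_le_compat_l; lra.
    - replace (Cmod (f z) * (eps / (2 * (Cmod (f z) + 1))))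
        with (eps / 2 - eps / (2 * (Cmod (f z) + 1))) by (field; lra).
      assert (0 < eps / (2 * (Cmod (f z) + 1))) by (apply Rdiv_lt_0_compat; lra). lra. }
  assert (ef * (Cmod (g z) + 1) = eps / 2) by (unfold ef; field; lra).
  lra.
Qed.

Lemma continuous_on_comp (S T : C -> Prop) (f g : C -> C) :
  continuous_on S g -> continuous_on T f -> (forall z, S z -> T (g z)) ->
  continuous_on S (fun z => f (g z)).
Proof.
  intros Hg Hf HST z Hz. apply (continuous_on_eps S (fun w => f (g w))). intros eps He.
  destruct (proj1 (continuous_on_eps _ _ _) (Hf (g z) (HST z Hz)) eps He) as (d1 & D1 & H1).
  destruct (proj1 (continuous_on_eps _ _ _) (Hg z Hz) d1 D1) as (d2 & D2 & H2).
  exists d2; split; [exact D2 |]. intros w Hw Hd. apply H1; auto.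
Qed.

(* Real and imaginary part of the integral of [F (x + i y) exp (- i l y)] over [y]. *)
Definition moment_re (F : C -> C) (l x : R) : R :=
  RInt (fun y => Re (F (x, y)) * cos (l * y) + Im (F (x, y)) * sin (l * y)) (- PI) PI.
Definition moment_im (F : C -> C) (l x : R) : R :=
  RInt (fun y => Im (F (x, y)) * cos (l * y) - Re (F (x, y)) * sin (l * y)) (- PI) PI.

Lemma RInt_scal_R (h : R -> R) (c a b : R) :
  (forall t, continuous h t) -> RInt (fun t => c * h t) a b = c * RInt h a b.
Proof.
  intros H. apply (RInt_scal (V := R_CompleteNormedModule)).
  apply ex_RInt_continuous_everywhere, H.
Qed.

Lemma continuous_cos_plus_sin (u v : R -> R) (l t : R) :
  continuous u t -> continuous v t ->
  continuous (fun y => u y * cos (l * y) + v y * sin (l * y)) t.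
Proof.
  intros Hu Hv. apply (continuous_plus (V := R_NormedModule));
    (apply continuous_Rmult; [assumption |]); [apply continuous_cos_mul | apply continuous_sin_mul].
Qed.

Lemma continuous_cos_minus_sin (u v : R -> R) (l t : R) :
  continuous u t -> continuous v t ->
  continuous (fun y => u y * cos (l * y) - v y * sin (l * y)) t.
Proof.
  intros Hu Hv. apply (continuous_minus (V := R_NormedModule));
    (apply continuous_Rmult; [assumption |]); [apply continuous_cos_mul | apply continuous_sin_mul].
Qed.

(** Strip invariance for [F u * cexp (- l * u)], whose modulus contributes the factor
    [exp (- l * x)]. The condition [sin (l * PI) = 0] makes the exponential agree at y = - PI and y
    = PI. *)
Lemma moment_invariant (F : C -> C) (al be l : R) :
  al <= be -> sin (l * PI) = 0 ->
  continuous_on (closed_strip al be) F ->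
  (forall z, al < Re z < be -> C_differentiable F z) ->
  (forall x, F (x, - PI) = F (x, PI)) ->
  exp (- l * al) * moment_re F l al = exp (- l * be) * moment_re F l be /\
  exp (- l * al) * moment_im F l al = exp (- l * be) * moment_im F l be.
Proof.
  intros [Hs | ->] Hl HC HD Hper; [| split; reflexivity].
  set (Phi := fun u => (F u * cexp (RtoC (- l) * u))%C).
  assert (PI_pos := PI_RGT_0).
  assert (Dexp : forall z, C_differentiable (fun u => cexp (RtoC (- l) * u)) z).
  { intros z. apply C_differentiable_comp; [apply C_differentiable_cexp |].
    apply C_differentiable_scal, C_differentiable_id. }
  destruct (RInt_strip_invariant Phi al be (- PI) PI Hs) as [ERe EIm].
  - lra.
  - apply continuous_on_mult; [exact HC |].
    intros z _. apply (C_differentiable_continuous_within (fun u => cexp (RtoC (- l) * u))), Dexp.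
  - intros z Hz. apply C_differentiable_mult; [apply HD; exact Hz | apply Dexp].
  - intros x _. unfold Phi. rewrite Hper. f_equal.
    unfold cexp, Cmult, RtoC; simpl.
    replace (- l * - PI + 0 * x) with (l * PI) by ring.
    replace (- l * PI + 0 * x) with (- (l * PI)) by ring.
    replace (- l * x - 0 * - PI) with (- l * x - 0 * PI) by ring.
    rewrite cos_neg, sin_neg, Hl. f_equal; ring.
  - assert (SR : forall x y, Re (Phi (x, y)) = exp (- l * x) *
      (Re (F (x, y)) * cos (l * y) + Im (F (x, y)) * sin (l * y))).
    { intros x y. unfold Phi, cexp, Cmult, RtoC; simpl.
      replace (- l * y + 0 * x) with (- (l * y)) by ring.
      replace (- l * x - 0 * y) with (- l * x) by ring.
      rewrite cos_neg, sin_neg. unfold Re, Im. ring. }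
    assert (SI : forall x y, Im (Phi (x, y)) = exp (- l * x) *
      (Im (F (x, y)) * cos (l * y) - Re (F (x, y)) * sin (l * y))).
    { intros x y. unfold Phi, cexp, Cmult, RtoC; simpl.
      replace (- l * y + 0 * x) with (- (l * y)) by ring.
      replace (- l * x - 0 * y) with (- l * x) by ring.
      rewrite cos_neg, sin_neg. unfold Re, Im. ring. }
    assert (MR : forall x, al <= x <= be ->
      RInt (fun y => Re (Phi (x, y))) (- PI) PI = exp (- l * x) * moment_re F l x).
    { intros x Hx. destruct (continuous_strip_slice F al be x Hx HC) as [KR KI].
      rewrite (RInt_ext _ _ _ _ (fun y _ => SR x y)). apply RInt_scal_R.
      intros t. apply continuous_cos_plus_sin; [apply KR | apply KI]. }
    assert (MI : forall x, al <= x <= be ->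
      RInt (fun y => Im (Phi (x, y))) (- PI) PI = exp (- l * x) * moment_im F l x).
    { intros x Hx. destruct (continuous_strip_slice F al be x Hx HC) as [KR KI].
      rewrite (RInt_ext _ _ _ _ (fun y _ => SI x y)). apply RInt_scal_R.
      intros t. apply continuous_cos_minus_sin; [apply KI | apply KR]. }
    rewrite !MR in ERe by lra. rewrite !MI in EIm by lra. auto.
Qed.

(** Sums and differences of the moments of index n and - n isolate the four real Fourier
    coefficients of the real and imaginary parts. *)
Lemma moments_zero_vanish (F : C -> C) (x : R) :
  (forall y, continuous (fun t => Re (F (x, t))) y) ->
  (forall y, continuous (fun t => Im (F (x, t))) y) ->
  (forall n : Z, moment_re F (IZR n) x = 0 /\ moment_im F (IZR n) x = 0) ->
  forall y, - PI <= y <= PI -> F (x, y) = RtoC 0.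
Proof.
  intros HR HI Hm.
  set (U := fun t => Re (F (x, t))). set (V := fun t => Im (F (x, t))).
  assert (E : forall n : nat,
    RInt (fun t => U t * cos (INR n * t)) (- PI) PI = 0 /\
    RInt (fun t => U t * sin (INR n * t)) (- PI) PI = 0 /\
    RInt (fun t => V t * cos (INR n * t)) (- PI) PI = 0 /\
    RInt (fun t => V t * sin (INR n * t)) (- PI) PI = 0).
  { intros n.
    assert (Uc : forall t, continuous (fun t => U t * cos (INR n * t)) t)
      by (intros; apply continuous_Rmult; [apply HR | apply continuous_cos_mul]).
    assert (Us : forall t, continuous (fun t => U t * sin (INR n * t)) t)
      by (intros; apply continuous_Rmult; [apply HR | apply continuous_sin_mul]).
    assert (Vc : forall t, continuous (fun t => V t * cos (INR n * t)) t)
      by (intros; apply continuous_Rmult; [apply HI | apply continuous_cos_mul]).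
    assert (Vs : forall t, continuous (fun t => V t * sin (INR n * t)) t)
      by (intros; apply continuous_Rmult; [apply HI | apply continuous_sin_mul]).
    destruct (Hm (Z.of_nat n)) as [A1 B1]. destruct (Hm (- Z.of_nat n)%Z) as [A2 B2].
    rewrite opp_IZR in A2, B2. rewrite <- INR_IZR_INZ in A1, B1, A2, B2.
    unfold moment_re, moment_im in *.
    rewrite (RInt_ext _ (fun t => 1 * (U t * cos (INR n * t)) + 1 * (V t * sin (INR n * t)))) in A1
      by (intros; unfold U, V; ring_R).
    rewrite (RInt_ext _ (fun t => 1 * (U t * cos (INR n * t)) + -1 * (V t * sin (INR n * t)))) in A2
      by (intros; unfold U, V; rewrite Ropp_mult_distr_l_reverse, cos_neg, sin_neg; ring_R).
    rewrite (RInt_ext _ (fun t => 1 * (V t * cos (INR n * t)) + -1 * (U t * sin (INR n * t)))) in B1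
      by (intros; unfold U, V; ring_R).
    rewrite (RInt_ext _ (fun t => 1 * (V t * cos (INR n * t)) + 1 * (U t * sin (INR n * t)))) in B2
      by (intros; unfold U, V; rewrite Ropp_mult_distr_l_reverse, cos_neg, sin_neg; ring_R).
    rewrite RInt_lin2 in A1, A2, B1, B2 by assumption.
    repeat split; lra. }
  intros y Hy.
  assert (U0 : U y = 0).
  { apply fourier_null_zero; [exact HR | | exact Hy].
    intros n. destruct (E n) as (A & B & _). exact (conj A B). }
  assert (V0 : V y = 0).
  { apply fourier_null_zero; [exact HI | | exact Hy].
    intros n. destruct (E n) as (_ & _ & A & B). exact (conj A B). }
  unfold U, V in *. destruct (F (x, y)) as [p q]. simpl in U0, V0. subst. reflexivity.
Qed.

(** * Elliptic coordinates *)

Lemma cosh2_sinh2 (x : R) : cosh x ^ 2 = 1 + sinh x ^ 2.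
Proof.
  assert (E : exp x * exp (- x) = 1) by (rewrite <- exp_plus, Rplus_opp_r; apply exp_0).
  unfold cosh, sinh. nra.
Qed.

Lemma cosh_pos (x : R) : 0 < cosh x.
Proof. unfold cosh. assert (A := exp_pos x). assert (B := exp_pos (- x)). lra. Qed.

Lemma cosh_opp (x : R) : cosh (- x) = cosh x.
Proof. unfold cosh. rewrite Ropp_involutive. f_equal. ring. Qed.

Lemma sinh_opp (x : R) : sinh (- x) = - sinh x.
Proof. unfold sinh. rewrite Ropp_involutive. field. Qed.

Lemma half_le_sinh (x : R) : 0 <= x -> x / 2 <= sinh x.
Proof.
  intros Hx. unfold sinh.
  assert (A : 1 + x <= exp x) by apply exp_ineq1_le.
  assert (B : exp (- x) <= exp 0) by (destruct Hx as [Hx | <-];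
    [left; apply exp_increasing; lra | right; f_equal; ring]).
  rewrite exp_0 in B. lra.
Qed.

Lemma unit_circle_angle (p q : R) :
  p ^ 2 + q ^ 2 = 1 -> exists y, - PI <= y <= PI /\ cos y = p /\ sin y = q.
Proof.
  intros H. assert (Hp : -1 <= p <= 1) by nra.
  assert (B := acos_bound p).
  assert (S : sin (acos p) = Rabs q).
  { rewrite sin_acos by exact Hp. rewrite <- sqrt_Rsqr_abs. f_equal. unfold Rsqr. nra. }
  destruct (Rle_dec 0 q) as [Hq | Hq].
  - exists (acos p). rewrite cos_acos, S, Rabs_pos_eq by lra. repeat split; lra.
  - exists (- acos p). rewrite cos_neg, sin_neg, cos_acos, S, Rabs_left by lra.
    repeat split; lra.
Qed.

(* [s = (sinh x) ^ 2] is the nonnegative root of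
   [k^2 s (1 + s) = p^2 s + q^2 (1 + s)]. *)
Lemma elliptic_coordinates (k p q : R) :
  0 < k -> exists x y, 0 <= x /\ - PI <= y <= PI /\
    p = k * (cosh x * cos y) /\ q = k * (sinh x * sin y).
Proof.
  intros Hk.
  set (m := p ^ 2 + q ^ 2 - k ^ 2).
  set (D := sqrt (m ^ 2 + 4 * k ^ 2 * q ^ 2)).
  assert (Hk2 : 0 < k ^ 2) by (apply pow_lt; exact Hk).
  assert (Hq2 := pow2_ge_0 q). assert (Hp2 := pow2_ge_0 p).
  assert (Hin : 0 <= m ^ 2 + 4 * k ^ 2 * q ^ 2)
    by (assert (A := pow2_ge_0 m); assert (0 <= k ^ 2 * q ^ 2) by (apply Rmult_le_pos; lra); lra).
  assert (HD : D ^ 2 = m ^ 2 + 4 * k ^ 2 * q ^ 2) by (apply pow2_sqrt; exact Hin).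
  assert (HD0 : 0 <= D) by apply sqrt_pos.
  assert (HDm : Rabs m <= D).
  { rewrite <- sqrt_Rsqr_abs. apply sqrt_le_1_alt. unfold Rsqr.
    assert (0 <= k ^ 2 * q ^ 2) by (apply Rmult_le_pos; lra). lra. }
  assert (HDm' : - m <= D) by (eapply Rle_trans; [| exact HDm]; rewrite <- Rabs_Ropp; apply RRle_abs).
  set (s := (m + D) / (2 * k ^ 2)).
  assert (Hs : 0 <= s) by (apply Rdiv_le_0_compat; lra).
  assert (Eq : k ^ 2 * s * (1 + s) = p ^ 2 * s + q ^ 2 * (1 + s)).
  { assert (Es : D = 2 * k ^ 2 * s - m) by (unfold s; field; lra).
    rewrite Es in HD. unfold m in HD. nra. }
  set (x := arcsinh (sqrt s)).
  assert (Hx : 0 <= x).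
  { unfold x. rewrite <- arcsinh_0. apply arcsinh_le, sqrt_pos. }
  assert (Sx : sinh x = sqrt s) by apply sinh_arcsinh.
  assert (Sx2 : sinh x ^ 2 = s) by (rewrite Sx; apply pow2_sqrt; exact Hs).
  assert (Cx2 : cosh x ^ 2 = 1 + s) by (rewrite cosh2_sinh2, Sx2; reflexivity).
  assert (Cx := cosh_pos x).
  destruct Hs as [Hs | Hs].
  - assert (Sp : 0 < sinh x) by (rewrite Sx; apply sqrt_lt_R0; exact Hs).
    destruct (unit_circle_angle (p / (k * cosh x)) (q / (k * sinh x))) as (y & Hy & Ec & Es).
    { replace ((p / (k * cosh x)) ^ 2 + (q / (k * sinh x)) ^ 2)
        with ((p ^ 2 * sinh x ^ 2 + q ^ 2 * cosh x ^ 2) / (k ^ 2 * sinh x ^ 2 * cosh x ^ 2))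
        by (field; repeat split; lra).
      rewrite Sx2, Cx2, <- Eq. field. repeat split; lra. }
    exists x, y. rewrite Ec, Es. split; [exact Hx |]. split; [exact Hy |].
    split; field; split; lra.
  (* Here the point lies on the segment between the foci: [sinh x = 0], so only the cosine of y
     counts and its sine may take either sign. *)
  - rewrite <- Hs in *.
    assert (q0 : q = 0) by nra.
    assert (pk : p ^ 2 <= k ^ 2).
    { assert (ED : m + D = 0) by (assert (E : s * (2 * k ^ 2) = m + D) by (unfold s; field; lra);
        rewrite <- Hs in E; lra).
      unfold m in *. rewrite q0 in *. lra. }
    destruct (unit_circle_angle (p / k) (sqrt (1 - (p / k) ^ 2))) as (y & Hy & Ec & _).
    { rewrite pow2_sqrt; [ring |].
      assert ((p / k) ^ 2 <= 1); [| lra].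
      replace ((p / k) ^ 2) with (p ^ 2 / k ^ 2) by (field; lra).
      apply Rle_div_l; lra. }
    exists 0, y. rewrite cosh_0, sinh_0, Ec, q0. split; [lra |]. split; [exact Hy |].
    split; field; lra.
Qed.

(** The foci are the images of 0 and of i PI, at distance k from the centre; all lines x = const > 0
    go to confocal ellipses. *)
Definition ell_map (c : C) (k th : R) (u : C) : C :=
  (c + (cos th, sin th) * (RtoC k * ccosh u))%C.

Lemma C_differentiable_ell_map (c : C) (k th : R) (u : C) :
  C_differentiable (ell_map c k th) u.
Proof.
  apply (C_differentiable_plus (fun _ => c)); [apply C_differentiable_const |].
  apply C_differentiable_scal, C_differentiable_scal, C_differentiable_ccosh.
Qed.

Lemma ell_map_periodic (c : C) (k th x : R) : ell_map c k th (x, - PI) = ell_map c k th (x, PI).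
Proof.
  unfold ell_map, ccosh; simpl. rewrite cos_neg, sin_neg, sin_PI, Ropp_0. reflexivity.
Qed.

(** This is [ccosh (- u) = ccosh u], evaluated at the point (x, - y). *)
Lemma ell_map_even (c : C) (k th x y : R) : ell_map c k th (- x, y) = ell_map c k th (x, - y).
Proof.
  unfold ell_map, ccosh; simpl. rewrite cosh_opp, sinh_opp, cos_neg, sin_neg.
  do 3 f_equal. f_equal. ring.
Qed.

Lemma ell_map_onto (c : C) (k th : R) (z : C) :
  0 < k -> exists x y, 0 <= x /\ - PI <= y <= PI /\ z = ell_map c k th (x, y).
Proof.
  (* The point seen in the axes of the ellipse, as in [ell_q]. *)
  intros Hk. set (w := ((z - c) * (cos th, (- sin th)%R))%C).
  destruct (elliptic_coordinates k (Re w) (Im w) Hk) as (x & y & Hx & Hy & E1 & E2).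
  exists x, y. split; [exact Hx |]. split; [exact Hy |].
  assert (Ew : (RtoC k * ccosh (x, y))%C = w).
  { rewrite (surjective_pairing w). unfold Re, Im in E1, E2. rewrite E1, E2.
    unfold ccosh, Cmult, RtoC; simpl. f_equal; ring. }
  unfold ell_map. rewrite Ew. unfold w.
  assert (T := sin2_cos2 th). unfold Rsqr in T.
  replace ((cos th, sin th) * ((z - c) * (cos th, (- sin th)%R)))%C
    with ((z - c) * ((cos th, sin th) * (cos th, (- sin th)%R)))%C by ring.
  replace ((cos th, sin th) * (cos th, (- sin th)%R))%C with (RtoC 1).
  - ring.
  - unfold Cmult, RtoC; simpl. f_equal; lra.
Qed.

(** With weights cos^2 y and sin^2 y of sum 1, the position relative to the ellipse depends only on
    comparing [sinh x ^ 2] with [sinh x0 ^ 2]. *)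
Lemma ell_q_ell_map (c : C) (k x0 th x y : R) :
  0 < k -> 0 < x0 ->
  ell_q c (k * cosh x0) (k * sinh x0) th (ell_map c k th (x, y)) =
  (1 + sinh x ^ 2) / (1 + sinh x0 ^ 2) * cos y ^ 2 + sinh x ^ 2 / sinh x0 ^ 2 * sin y ^ 2.
Proof.
  intros Hk Hx0.
  assert (Sp : 0 < sinh x0) by (rewrite <- sinh_0; apply sinh_lt; exact Hx0).
  assert (Cp := cosh_pos x0).
  unfold ell_q, ell_map.
  assert (T := sin2_cos2 th). unfold Rsqr in T.
  replace ((c + (cos th, sin th) * (RtoC k * ccosh (x, y)) - c) * (cos th, (- sin th)%R))%C
    with ((RtoC k * ccosh (x, y)) * ((cos th, sin th) * (cos th, (- sin th)%R)))%C by ring.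
  replace ((cos th, sin th) * (cos th, (- sin th)%R))%C with (RtoC 1)
    by (unfold Cmult, RtoC; simpl; f_equal; lra).
  rewrite <- !cosh2_sinh2. unfold ccosh, Cmult, RtoC; simpl. field. split; lra.
Qed.

Lemma sinh2_lt (x y : R) : Rabs x < y -> sinh x ^ 2 < sinh y ^ 2.
Proof.
  intros H. apply Rabs_lt_between in H.
  assert (A : sinh x < sinh y) by (apply sinh_lt; lra).
  assert (B : sinh (- y) < sinh x) by (apply sinh_lt; lra).
  rewrite sinh_opp in B. nra.
Qed.

Lemma convex_comb_lt (r a b p q : R) :
  a < r -> b < r -> 0 <= p -> 0 <= q -> p + q = 1 -> a * p + b * q < r.
Proof. intros Ha Hb Hp Hq E. destruct (Rle_dec (1 / 2) p); nra. Qed.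

Lemma ell_q_inside (c : C) (k x0 th x y : R) :
  0 < k -> 0 < x0 -> Rabs x < x0 ->
  ell_q c (k * cosh x0) (k * sinh x0) th (ell_map c k th (x, y)) < 1.
Proof.
  intros Hk Hx0 Hx. rewrite ell_q_ell_map by assumption.
  assert (L := sinh2_lt x x0 Hx). assert (S := pow2_ge_0 (sinh x)).
  assert (A : (1 + sinh x ^ 2) / (1 + sinh x0 ^ 2) < 1) by (apply Rlt_div_l; lra).
  assert (B : sinh x ^ 2 / sinh x0 ^ 2 < 1) by (apply Rlt_div_l; lra).
  assert (T := sin2_cos2 y). unfold Rsqr in T.
  assert (C1 := pow2_ge_0 (cos y)). assert (S1 := pow2_ge_0 (sin y)).
  apply convex_comb_lt; lra.
Qed.

Lemma ell_q_outside (c : C) (k x0 th x y : R) :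
  0 < k -> 0 < x0 -> x0 < x ->
  1 < ell_q c (k * cosh x0) (k * sinh x0) th (ell_map c k th (x, y)).
Proof.
  intros Hk Hx0 Hx. rewrite ell_q_ell_map by assumption.
  assert (L : sinh x0 ^ 2 < sinh x ^ 2) by (apply sinh2_lt; rewrite Rabs_pos_eq; lra).
  assert (Sp : 0 < sinh x0) by (rewrite <- sinh_0; apply sinh_lt; exact Hx0).
  assert (S : 0 < sinh x0 ^ 2) by (apply pow_lt; exact Sp).
  assert (A : 1 < (1 + sinh x ^ 2) / (1 + sinh x0 ^ 2)) by (apply Rlt_div_r; lra).
  assert (B : 1 < sinh x ^ 2 / sinh x0 ^ 2) by (apply Rlt_div_r; lra).
  assert (T := sin2_cos2 y). unfold Rsqr in T.
  assert (C1 := pow2_ge_0 (cos y)). assert (S1 := pow2_ge_0 (sin y)).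
  (* Changing signs turns the lower bound into an instance of [convex_comb_lt]. *)
  apply Ropp_lt_cancel.
  eapply Rle_lt_trans; [| apply (convex_comb_lt (-1) (- ((1 + sinh x ^ 2) / (1 + sinh x0 ^ 2)))
    (- (sinh x ^ 2 / sinh x0 ^ 2)) (cos y ^ 2) (sin y ^ 2)); lra].
  right. ring.
Qed.

Lemma ell_q_curve (c : C) (k x0 th x y : R) :
  0 < k -> 0 < x0 -> Rabs x = x0 ->
  ell_q c (k * cosh x0) (k * sinh x0) th (ell_map c k th (x, y)) = 1.
Proof.
  intros Hk Hx0 Hx. rewrite ell_q_ell_map by assumption.
  assert (E : sinh x ^ 2 = sinh x0 ^ 2).
  { rewrite <- Hx. unfold Rabs. destruct Rcase_abs; [rewrite sinh_opp; ring | reflexivity]. }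
  assert (Sp : 0 < sinh x0) by (rewrite <- sinh_0; apply sinh_lt; exact Hx0).
  assert (S : 0 < sinh x0 ^ 2) by (apply pow_lt; exact Sp).
  assert (T := sin2_cos2 y). unfold Rsqr in T.
  rewrite E.
  transitivity (cos y ^ 2 + sin y ^ 2); [field; split; lra | lra].
Qed.

(** The squared modulus of [ccosh (x, y)] is sinh^2 x + cos^2 y, and sinh x >= x / 2. The bound is
    uniform in y, so a whole vertical line goes to infinity at once. *)
Lemma Cmod_ell_map_ge (c : C) (k th x y : R) :
  0 < k -> 0 <= x -> k * (x / 2) - Cmod c <= Cmod (ell_map c k th (x, y)).
Proof.
  intros Hk Hx.
  assert (A : sinh x <= Cmod (ccosh (x, y))).
  { assert (H := half_le_sinh x Hx).
    rewrite <- (sqrt_pow2 (sinh x)) by lra. unfold Cmod, ccosh; simpl fst; simpl snd.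
    apply sqrt_le_1_alt. rewrite !Rpow_mult_distr, cosh2_sinh2.
    assert (T := sin2_cos2 y). unfold Rsqr in T.
    assert (C1 := pow2_ge_0 (cos y)). simpl in *. nra. }
  assert (B : Cmod (cos th, sin th) = 1).
  { unfold Cmod; simpl fst; simpl snd. rewrite <- sqrt_1. f_equal.
    assert (T := sin2_cos2 th). unfold Rsqr in T. simpl. lra. }
  assert (E : Cmod ((cos th, sin th) * (RtoC k * ccosh (x, y))) = k * Cmod (ccosh (x, y))).
  { rewrite !Cmod_mult, B, Cmod_R, Rabs_pos_eq by lra. ring. }
  assert (T := Cmod_triangle (ell_map c k th (x, y)) (- c)).
  replace (ell_map c k th (x, y) + - c)%C
    with ((cos th, sin th) * (RtoC k * ccosh (x, y)))%C in T by (unfold ell_map; ring).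
  rewrite E, Cmod_opp in T.
  assert (H := half_le_sinh x Hx).
  assert (k * (x / 2) <= k * Cmod (ccosh (x, y))) by (apply Rmult_le_compat_l; lra).
  lra.
Qed.

(** Differentiability of the chart at 0 gives continuity there, and the chart has value 0 at 0. *)
Lemma vanishes_at_infinity (g : C -> C) :
  C_differentiable (chart_at_infty g) (RtoC 0) ->
  forall eps, 0 < eps -> exists M, forall z, M < Cmod z -> Cmod (g z) < eps.
Proof.
  intros HD eps He.
  assert (H := C_differentiable_continuous_within _ (fun _ => True) _ HD).
  destruct (proj1 (continuous_on_eps _ _ _) H eps He) as (d & Hd & Hw).
  exists (/ d). intros z Hz.
  assert (Hd' : 0 < / d) by (apply Rinv_0_lt_compat; exact Hd).
  assert (z0 : z <> RtoC 0) by (intros ->; rewrite Cmod_0 in Hz; lra).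
  assert (Mi : Cmod (/ z) = / Cmod z) by (apply Cmod_inv; exact z0).
  assert (Mp : 0 < / Cmod z) by (apply Rinv_0_lt_compat; lra).
  specialize (Hw (/ z)%C I).
  assert (E1 : chart_at_infty g (/ z)%C = g z).
  { unfold chart_at_infty. destruct (Req_EM_T (Cmod (/ z)) 0) as [E | E]; [lra |].
    f_equal. field. exact z0. }
  assert (E0 : chart_at_infty g (RtoC 0) = RtoC 0).
  { unfold chart_at_infty. destruct (Req_EM_T (Cmod 0) 0) as [E | E]; [reflexivity |].
    rewrite Cmod_0 in E. contradiction. }
  rewrite E1, E0 in Hw.
  replace (/ z - 0)%C with (/ z)%C in Hw by ring.
  replace (g z - 0)%C with (g z) in Hw by ring.
  apply Hw. rewrite Mi, <- (Rinv_inv d). apply Rinv_lt_contravar; [| exact Hz].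
  apply Rmult_lt_0_compat; lra.
Qed.

(** * The matching problem *)

Lemma RInt_reflect (h : R -> R) (r : R) :
  (forall t, continuous h t) -> RInt (fun y => h (- y)) (- r) r = RInt h (- r) r.
Proof.
  intros Hc.
  assert (E := RInt_comp_lin (V := R_CompleteNormedModule) h (-1) 0 (- r) r
    (ex_RInt_continuous_everywhere h _ _ Hc)).
  replace (-1 * - r + 0) with r in E by ring. replace (-1 * r + 0) with (- r) in E by ring.
  rewrite <- (opp_RInt_swap (V := R_CompleteNormedModule) h (- r) r) in E
    by (apply ex_RInt_continuous_everywhere, Hc).
  rewrite (RInt_ext _ (fun y => -1 * h (- y))) in E.
  - rewrite RInt_scal_R in E.
    + change (-1 * RInt (fun y => h (- y)) (- r) r = - RInt h (- r) r) in E. lra.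
    + intros t. apply (continuous_comp Ropp h); [| apply Hc].
      apply (continuous_opp (V := R_NormedModule)), continuous_id.
  - intros y _. change (-1 * h (-1 * y + 0) = -1 * h (- y)). do 2 f_equal. ring.
Qed.

(** The substitution y -> - y turns the frequency l into - l. *)
Lemma moment_reflect (F : C -> C) (l x : R) :
  (forall y, F (- x, y) = F (x, - y)) ->
  (forall y, continuous (fun t => Re (F (x, t))) y) ->
  (forall y, continuous (fun t => Im (F (x, t))) y) ->
  moment_re F l (- x) = moment_re F (- l) x /\ moment_im F l (- x) = moment_im F (- l) x.
Proof.
  intros HF HR HI. unfold moment_re, moment_im. split.
  - rewrite <- (RInt_reflect (fun y => Re (F (x, y)) * cos (- l * y) + Im (F (x, y)) * sin (- l * y))).
    + apply RInt_ext. intros y _. rewrite HF. replace (- l * - y) with (l * y) by ring. reflexivity.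
    + intros t. apply continuous_cos_plus_sin; auto.
  - rewrite <- (RInt_reflect (fun y => Im (F (x, y)) * cos (- l * y) - Re (F (x, y)) * sin (- l * y))).
    + apply RInt_ext. intros y _. rewrite HF. replace (- l * - y) with (l * y) by ring. reflexivity.
    + intros t. apply continuous_cos_minus_sin; auto.
Qed.

(** Conjugation reverses frequencies: the moment of F of index - l is the conjugate of that of G of
    index l. *)
Lemma moment_conj (F G : C -> C) (l x : R) :
  (forall y, F (x, y) = Cconj (G (x, y))) ->
  (forall y, continuous (fun t => Re (G (x, t))) y) ->
  (forall y, continuous (fun t => Im (G (x, t))) y) ->
  moment_re F (- l) x = moment_re G l x /\ moment_im F (- l) x = - moment_im G l x.
Proof.
  intros HF HR HI. unfold moment_re, moment_im. split.
  - apply RInt_ext. intros y _. rewrite HF. rewrite Ropp_mult_distr_l_reverse, cos_neg, sin_neg.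
    destruct (G (x, y)). simpl. ring_R.
  - rewrite (RInt_ext _ (fun y => -1 * (Im (G (x, y)) * cos (l * y) - Re (G (x, y)) * sin (l * y)))).
    + rewrite RInt_scal_R; [ring_R |]. intros t. apply continuous_cos_minus_sin; auto.
    + intros y _. rewrite HF. rewrite Ropp_mult_distr_l_reverse, cos_neg, sin_neg.
      destruct (G (x, y)). simpl. ring_R.
Qed.

Lemma moment_bound (F : C -> C) (l x eps : R) :
  (forall y, continuous (fun t => Re (F (x, t))) y) ->
  (forall y, continuous (fun t => Im (F (x, t))) y) ->
  (forall y, Cmod (F (x, y)) <= eps) ->
  Rabs (moment_re F l x) <= 2 * PI * (2 * eps) /\ Rabs (moment_im F l x) <= 2 * PI * (2 * eps).
Proof.
  intros HR HI Hb. assert (PI_pos := PI_RGT_0).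
  replace (2 * PI) with (PI - - PI) by ring.
  assert (trig : forall p q y, Rabs p <= eps -> Rabs q <= eps ->
    Rabs (p * cos (l * y)) <= eps /\ Rabs (q * sin (l * y)) <= eps).
  { intros p q y Hp Hq. rewrite !Rabs_mult.
    assert (Rabs (cos (l * y)) <= 1) by (apply Rabs_le, COS_bound).
    assert (Rabs (sin (l * y)) <= 1) by (apply Rabs_le, SIN_bound).
    assert (A := Rabs_pos p). assert (B := Rabs_pos q). split; nra. }
  split.
  - apply abs_RInt_le_const; [lra | |].
    + apply ex_RInt_continuous_everywhere. intros t. apply continuous_cos_plus_sin; auto.
    + intros y _. assert (A := Rabs_Re_le_Cmod (F (x, y))). assert (B := Rabs_Im_le_Cmod (F (x, y))).
      specialize (Hb y). eapply Rle_trans; [apply Rabs_triang |].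
      destruct (trig (Re (F (x, y))) (Im (F (x, y))) y); lra.
  - apply abs_RInt_le_const; [lra | |].
    + apply ex_RInt_continuous_everywhere. intros t. apply continuous_cos_minus_sin; auto.
    + intros y _. assert (A := Rabs_Re_le_Cmod (F (x, y))). assert (B := Rabs_Im_le_Cmod (F (x, y))).
      specialize (Hb y). unfold Rminus. eapply Rle_trans; [apply Rabs_triang |]. rewrite Rabs_Ropp.
      destruct (trig (Im (F (x, y))) (Re (F (x, y))) y); lra.
Qed.

Lemma sin_IZR_PI (n : Z) : sin (IZR n * PI) = 0.
Proof. apply sin_eq_0_1. exists n. reflexivity. Qed.

(* Since [G] decays at the right end of the half-strip, the invariant
   [exp (- n x) * moment] must be zero for [n >= 0]. *)
Lemma moment_halfstrip_zero (G : C -> C) (x0 : R) (n : nat) :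
  (forall X, x0 <= X -> continuous_on (closed_strip x0 X) G) ->
  (forall z, x0 < Re z -> C_differentiable G z) ->
  (forall x, G (x, - PI) = G (x, PI)) ->
  (forall eps, 0 < eps -> exists X, x0 <= X /\ forall y, Cmod (G (X, y)) <= eps) ->
  moment_re G (INR n) x0 = 0 /\ moment_im G (INR n) x0 = 0.
Proof.
  intros HC HD Hper Hdec.
  assert (PI_pos := PI_RGT_0).
  assert (K : forall eps, 0 < eps ->
    Rabs (moment_re G (INR n) x0) < eps /\ Rabs (moment_im G (INR n) x0) < eps).
  { intros eps He.
    (* With this choice the bound [2 * PI * (2 * _)] of [moment_bound] becomes [eps / 2]. *)
    destruct (Hdec (eps / (8 * PI))) as (X & HX & HG); [apply Rdiv_lt_0_compat; lra |].
    assert (S : sin (INR n * PI) = 0) by (rewrite INR_IZR_INZ; apply sin_IZR_PI).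
    destruct (moment_invariant G x0 X (INR n) HX S (HC X HX)) as [E1 E2];
      [intros z Hz; apply HD, Hz | exact Hper |].
    assert (Sl := continuous_strip_slice G x0 X X ltac:(lra) (HC X HX)).
    destruct (moment_bound G (INR n) X (eps / (8 * PI))) as [B1 B2];
      [exact (proj1 Sl) | exact (proj2 Sl) | exact HG |].
    replace (2 * PI * (2 * (eps / (8 * PI)))) with (eps / 2) in B1, B2 by (field; lra).
    assert (e0 := exp_pos (- INR n * x0)). assert (eX := exp_pos (- INR n * X)).
    assert (Hn : 0 <= INR n) by apply pos_INR.
    (* The sign of n enters here: for n >= 0 the weight does not grow with x. For n = 0 it is
       constant, and the decay of [G] alone makes the moment vanish. *)
    assert (le : exp (- INR n * X) <= exp (- INR n * x0)).
    { destruct (Rle_lt_or_eq_dec (- INR n * X) (- INR n * x0)) as [L | L]; [nra | |].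
      - left. apply exp_increasing, L.
      - right. f_equal. exact L. }
    assert (F : forall m m', exp (- INR n * x0) * m = exp (- INR n * X) * m' ->
      Rabs m' <= eps / 2 -> Rabs m < eps).
    { intros m m' E B.
      apply Rmult_lt_reg_l with (exp (- INR n * x0)); [exact e0 |].
      assert (A : exp (- INR n * x0) * Rabs m = exp (- INR n * X) * Rabs m').
      { rewrite <- (Rabs_pos_eq (exp (- INR n * x0))), <- (Rabs_pos_eq (exp (- INR n * X))) by lra.
        rewrite <- !Rabs_mult, E. reflexivity. }
      rewrite A. assert (P := Rabs_pos m'). nra. }
    split; [exact (F _ _ E1 B1) | exact (F _ _ E2 B2)]. }
  split; apply Req_lt_aux; intros [eps He]; rewrite Rminus_0_r; apply K; exact He.
Qed.

(** The pulled back [F] is studied on the full strip |x| <= x0, which covers the interior twice; [G]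
    on x >= x0. *)
Lemma matching_zero (c : C) (k x0 th : R) (f g : C -> C) :
  0 < k -> 0 < x0 ->
  matching_solution c (k * cosh x0) (k * sinh x0) th f g ->
  (forall z, ell_interior_closure c (k * cosh x0) (k * sinh x0) th z -> f z = RtoC 0) /\
  (forall z, ell_exterior_closure c (k * cosh x0) (k * sinh x0) th z -> g z = RtoC 0).
Proof.
  intros Hk Hx0 (Hf & Cf & Hg & Hinf & Cg & Hfg).
  set (W := ell_map c k th).
  set (F := fun u => f (W u)). set (G := fun u => g (W u)).
  assert (CZ : forall S, continuous_on S W).
  { intros S z _. apply C_differentiable_continuous_within, C_differentiable_ell_map. }
  assert (Fin : forall u, - x0 <= Re u <= x0 ->
    ell_interior_closure c (k * cosh x0) (k * sinh x0) th (W u)).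
  { intros [x y] Hu. simpl in Hu. unfold ell_interior_closure, W.
    assert (B : Rabs x <= x0) by (apply Rabs_le; lra). destruct B as [B | B].
    - left. apply ell_q_inside; assumption.
    - right. apply ell_q_curve; assumption. }
  assert (Gin : forall u, x0 <= Re u ->
    ell_exterior_closure c (k * cosh x0) (k * sinh x0) th (W u)).
  { intros [x y] Hu. simpl in Hu. unfold ell_exterior_closure, W.
    destruct Hu as [B | B].
    - left. apply ell_q_outside; assumption.
    - right. symmetry. apply ell_q_curve; [assumption .. | rewrite Rabs_pos_eq; lra]. }
  assert (CF : forall x, - x0 <= x -> continuous_on (closed_strip x x0) F).
  { intros x Hx. apply (continuous_on_comp _ _ f W (CZ _) Cf). intros u Hu. apply Fin.
    unfold closed_strip in Hu. lra. }
  assert (CG : forall X, continuous_on (closed_strip x0 X) G).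
  { intros X. apply (continuous_on_comp _ _ g W (CZ _) Cg). intros u Hu. apply Gin, Hu. }
  assert (DF : forall u, - x0 < Re u < x0 -> C_differentiable F u).
  { intros [x y] Hu. simpl in Hu. apply (C_differentiable_comp f W); [| apply C_differentiable_ell_map].
    apply Hf, ell_q_inside; [assumption .. | apply Rabs_def1; lra]. }
  assert (DG : forall u, x0 < Re u -> C_differentiable G u).
  { intros [x y] Hu. simpl in Hu. apply (C_differentiable_comp g W); [| apply C_differentiable_ell_map].
    apply Hg, ell_q_outside; assumption. }
  assert (PF : forall x, F (x, - PI) = F (x, PI))
    by (intros x; unfold F, W; rewrite ell_map_periodic; reflexivity).
  assert (PG : forall x, G (x, - PI) = G (x, PI))
    by (intros x; unfold G, W; rewrite ell_map_periodic; reflexivity).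
  assert (EF : forall y, F (- x0, y) = F (x0, - y))
    by (intros y; unfold F, W; rewrite ell_map_even; reflexivity).
  assert (FG : forall y, F (x0, y) = Cconj (G (x0, y))).
  { intros y. apply Hfg. apply ell_q_curve; [assumption .. | apply Rabs_pos_eq; lra]. }
  assert (SF : forall x, - x0 <= x <= x0 ->
    (forall y, continuous (fun t => Re (F (x, t))) y) /\
    (forall y, continuous (fun t => Im (F (x, t))) y)).
  { intros x Hx. apply (continuous_strip_slice F (- x0) x0 x Hx). apply CF. lra. }
  assert (SG : forall x, x0 <= x ->
    (forall y, continuous (fun t => Re (G (x, t))) y) /\
    (forall y, continuous (fun t => Im (G (x, t))) y)).
  { intros x Hx. apply (continuous_strip_slice G x0 x x); [lra | apply CG]. }
  assert (SF0 := SF x0 ltac:(lra)). assert (SG0 := SG x0 ltac:(lra)).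
  assert (decG : forall eps, 0 < eps -> exists X, x0 <= X /\ forall y, Cmod (G (X, y)) <= eps).
  { intros eps He. destruct (vanishes_at_infinity g Hinf eps He) as [M HM].
    set (X := Rmax x0 (2 * (M + Cmod c + 1) / k)).
    assert (X1 : x0 <= X) by apply Rmax_l.
    assert (X2 : 2 * (M + Cmod c + 1) / k <= X) by apply Rmax_r.
    exists X. split; [exact X1 |]. intros y. left. apply HM.
    assert (B := Cmod_ell_map_ge c k th X y Hk ltac:(lra)).
    apply Rle_div_l in X2; [| exact Hk]. fold W in B. lra. }
  assert (MG0 : forall n : nat, moment_re G (INR n) x0 = 0 /\ moment_im G (INR n) x0 = 0).
  { intros n. apply moment_halfstrip_zero; auto. }
  assert (expn0 : forall t, exp t <> 0) by (intros t; assert (H := exp_pos t); lra).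
  (* Index - n vanishes by conjugation from [G]. Reflection makes it the moment of index n on the
     line - x0, and invariance carries that zero to x0. *)
  assert (MF0 : forall n : nat,
    (moment_re F (INR n) x0 = 0 /\ moment_im F (INR n) x0 = 0) /\
    (moment_re F (- INR n) x0 = 0 /\ moment_im F (- INR n) x0 = 0)).
  { intros n.
    destruct (MG0 n) as [G1 G2].
    destruct (moment_conj F G (INR n) x0 FG) as [J1 J2]; [exact (proj1 SG0) | exact (proj2 SG0) |].
    destruct (moment_reflect F (INR n) x0 EF) as [R1 R2]; [exact (proj1 SF0) | exact (proj2 SF0) |].
    rewrite G1 in J1. rewrite G2, Ropp_0 in J2.
    assert (S : sin (INR n * PI) = 0) by (rewrite INR_IZR_INZ; apply sin_IZR_PI).
    destruct (moment_invariant F (- x0) x0 (INR n)) as [I1 I2];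
      [lra | exact S | apply CF; lra | exact DF | exact PF |].
    rewrite R1, J1, Rmult_0_r in I1. rewrite R2, J2, Rmult_0_r in I2.
    symmetry in I1, I2. apply Rmult_integral in I1. apply Rmult_integral in I2.
    destruct I1 as [I1 | I1]; [exfalso; exact (expn0 _ I1) |].
    destruct I2 as [I2 | I2]; [exfalso; exact (expn0 _ I2) |].
    auto. }
  assert (IZR_cases : forall n : Z, exists m : nat, IZR n = INR m \/ IZR n = - INR m).
  { intros n. exists (Z.abs_nat n). rewrite INR_IZR_INZ, Zabs2Nat.id_abs, <- opp_IZR.
    destruct (Z.abs_eq_or_opp n) as [E | E]; [left | right]; f_equal; lia. }
  assert (MF : forall n : Z, moment_re F (IZR n) x0 = 0 /\ moment_im F (IZR n) x0 = 0).
  { intros n. destruct (IZR_cases n) as (m & [-> | ->]);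
      [exact (proj1 (MF0 m)) | exact (proj2 (MF0 m))]. }
  (* Decay gave only the indices n >= 0 of [G]; conjugating back from [F] gives the negative ones
     too. *)
  assert (MG : forall n : Z, moment_re G (IZR n) x0 = 0 /\ moment_im G (IZR n) x0 = 0).
  { intros n. destruct (moment_conj F G (IZR n) x0 FG) as [J1 J2];
      [exact (proj1 SG0) | exact (proj2 SG0) |].
    rewrite <- opp_IZR in J1, J2. destruct (MF (- n)%Z) as [A B]. rewrite A in J1. rewrite B in J2.
    split; lra. }
  assert (cancel : forall s t m m', exp s * m = exp t * m' -> m = 0 -> m' = 0).
  { intros s t m m' E ->. rewrite Rmult_0_r in E. symmetry in E.
    apply Rmult_integral in E. destruct E as [E | E]; [exfalso; exact (expn0 _ E) | exact E]. }
  (* Invariance between x and x0 makes all moments zero on each vertical line, so uniqueness of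
     Fourier coefficients applies line by line. *)
  assert (F0 : forall x y, - x0 <= x <= x0 -> - PI <= y <= PI -> F (x, y) = RtoC 0).
  { intros x y Hx. revert y.
    apply moments_zero_vanish; [exact (proj1 (SF x Hx)) | exact (proj2 (SF x Hx)) |].
    intros n. destruct (moment_invariant F x x0 (IZR n)) as [I1 I2];
      [lra | apply sin_IZR_PI | apply CF; lra | intros u Hu; apply DF; lra | exact PF |].
    destruct (MF n) as [A B]. exact (conj (cancel _ _ _ _ (eq_sym I1) A) (cancel _ _ _ _ (eq_sym I2) B)). }
  assert (G0 : forall x y, x0 <= x -> - PI <= y <= PI -> G (x, y) = RtoC 0).
  { intros x y Hx. revert y.
    apply moments_zero_vanish; [exact (proj1 (SG x Hx)) | exact (proj2 (SG x Hx)) |].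
    intros n. destruct (moment_invariant G x0 x (IZR n)) as [I1 I2];
      [lra | apply sin_IZR_PI | apply CG | intros u Hu; apply DG; lra | exact PG |].
    destruct (MG n) as [A B]. exact (conj (cancel _ _ _ _ I1 A) (cancel _ _ _ _ I2 B)). }
  (* Every z has coordinates with x >= 0; its side of the curve decides whether x <= x0 or x >=
     x0. *)
  split; intros z Hz; destruct (ell_map_onto c k th z Hk) as (x & y & Hx & Hy & ->).
  - apply (F0 x y); [| exact Hy]. split; [lra |].
    destruct (Rle_dec x x0) as [L | L]; [exact L |]. exfalso.
    assert (Q := ell_q_outside c k x0 th x y Hk Hx0 ltac:(lra)).
    unfold ell_interior_closure in Hz. lra.
  - apply (G0 x y); [| exact Hy].
    destruct (Rle_dec x0 x) as [L | L]; [exact L |]. exfalso.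
    assert (Q := ell_q_inside c k x0 th x y Hk Hx0 ltac:(rewrite Rabs_pos_eq; lra)).
    unfold ell_exterior_closure in Hz. lra.
Qed.

(** * From semi-axes to focal coordinates *)

(** k is the distance from the centre to a focus, positive exactly because the axes differ; then
    sinh x0 = b / k, and cosh x0 = a / k follows from cosh^2 - sinh^2 = 1. *)
Lemma focal_parameters (a b : R) :
  0 < b -> b < a -> exists k x0, 0 < k /\ 0 < x0 /\ a = k * cosh x0 /\ b = k * sinh x0.
Proof.
  intros Hb Hab.
  set (k := sqrt (a ^ 2 - b ^ 2)).
  assert (Hd : 0 < a ^ 2 - b ^ 2) by nra.
  assert (Hk : 0 < k) by (apply sqrt_lt_R0; exact Hd).
  assert (Hk2 : k ^ 2 = a ^ 2 - b ^ 2) by (apply pow2_sqrt; lra).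
  assert (Hbk : 0 < b / k) by (apply Rdiv_lt_0_compat; assumption).
  exists k, (arcsinh (b / k)).
  assert (S : sinh (arcsinh (b / k)) = b / k) by apply sinh_arcsinh.
  assert (C2 := cosh2_sinh2 (arcsinh (b / k))).
  assert (Cp := cosh_pos (arcsinh (b / k))).
  split; [exact Hk |]. split; [rewrite <- arcsinh_0; apply arcsinh_lt; exact Hbk |].
  split; [| rewrite S; field; lra].
  rewrite S in C2. set (h := cosh (arcsinh (b / k))) in *.
  assert (E : (k * h) ^ 2 = a ^ 2).
  { rewrite Rpow_mult_distr, C2.
    replace (k ^ 2 * (1 + (b / k) ^ 2)) with (k ^ 2 + b ^ 2) by (field; lra). lra. }
  assert (0 < k * h) by (apply Rmult_lt_0_compat; assumption). nra.
Qed.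

(** A quarter turn exchanges the axes, so the first semi-axis may be taken to be the larger one. *)
Lemma ell_q_swap (c : C) (a b th : R) (z : C) :
  ell_q c b a (th + PI / 2) z = ell_q c a b th z.
Proof.
  unfold ell_q. rewrite cos_plus, sin_plus, cos_PI2, sin_PI2. simpl.
  rewrite !Rmult_0_r, !Rmult_1_r. unfold Rdiv. ring.
Qed.

Lemma matching_solution_swap (c : C) (a b th : R) (f g : C -> C) :
  matching_solution c a b th f g -> matching_solution c b a (th + PI / 2) f g.
Proof.
  assert (E := ell_q_swap c a b th).
  intros (Hf & Cf & Hg & Hinf & Cg & Hfg).
  assert (Ein : forall z, ell_interior_closure c b a (th + PI / 2) z -> ell_interior_closure c a b th z)
    by (intros z; unfold ell_interior_closure; rewrite E; auto).
  assert (Eout : forall z, ell_exterior_closure c b a (th + PI / 2) z -> ell_exterior_closure c a b th z)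
    by (intros z; unfold ell_exterior_closure; rewrite E; auto).
  repeat split.
  - intros z Hz. apply Hf. unfold ell_interior in *. rewrite <- E. exact Hz.
  - exact (continuous_on_subset _ _ f Ein Cf).
  - intros z Hz. apply Hg. unfold ell_exterior in *. rewrite <- E. exact Hz.
  - exact Hinf.
  - exact (continuous_on_subset _ _ g Eout Cg).
  - intros z Hz. apply Hfg. unfold ellipse in *. rewrite <- E. exact Hz.
Qed.

Theorem theorem3p21 (c : C) (a b th : R) (f g : C -> C) :
  0 < b -> 0 < a -> a <> b ->
  matching_solution c a b th f g ->
  (exists k : C, forall z, ell_interior_closure c a b th z -> f z = k) /\
  (exists k : C, forall z, ell_exterior_closure c a b th z -> g z = k).
Proof.
  intros Hb Ha Hab H.
  destruct (Rtotal_order a b) as [L | [L | L]]; [| contradiction |].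
  - apply matching_solution_swap in H.
    destruct (focal_parameters b a Ha L) as (k & x0 & Hk & Hx0 & -> & ->).
    destruct (matching_zero c k x0 _ f g Hk Hx0 H) as [F0 G0].
    split; exists (RtoC 0); intros z Hz.
    + apply F0. unfold ell_interior_closure in *. rewrite ell_q_swap. exact Hz.
    + apply G0. unfold ell_exterior_closure in *. rewrite ell_q_swap. exact Hz.
  - destruct (focal_parameters a b Hb L) as (k & x0 & Hk & Hx0 & -> & ->).
    destruct (matching_zero c k x0 th f g Hk Hx0 H) as [F0 G0].
    split; exists (RtoC 0); assumption.
Qed.
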